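(* For every integer $k\ge 1$ and every $0<\alpha<1$ there are constants $M=M(\alpha,k)\in\mathbb{N}$, $c_1=c_1(k)$ (depending only on $k$), and $c_2$ (an absolute constant) such that the following holds. Let $\epsilon\ge 0$, let $\mathcal{M}$ be any metric space, and let $f:[0,1]^k\to\mathcal{M}$ be an $\epsilon$-coarse $1$-Lipschitz function, i.e. $\mathrm{dist}(f(x),f(y))\le |x-y|+\epsilon$ for all $x,y\in[0,1]^k$. Then there are sets $F_1,\dots,F_M\subset[0,1]^k$ such that for every $1\le i\le M$ and all $x,y\in F_i$, $$\alpha|x-y|-c_2\epsilon\le \mathrm{dist}(f(x),f(y))\le |x-y|+\epsilon,$$ and $$h^k\big(f([0,1]^k\setminus(F_1\cup\dots\cup F_M))\big)\le c_1\alpha .$$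
   Context: $|x-y|$ is the Euclidean distance on $\mathbb{R}^k$ and $\mathrm{dist}$ is the metric of $\mathcal{M}$. For a subset $E$ of a metric space, the $k$-dimensional Hausdorff content is $h^k(E)=\inf\{\sum_i \mathrm{diam}(U_i)^k : \bigcup_i U_i\supset E\}$, the infimum being over countable covers. The constants $M,c_1,c_2$ do not depend on $\mathcal{M}$, $f$ or $\epsilon$. *)

(* Defs.v *)
From HB Require Import structures.
From mathcomp Require Import all_boot all_order all_algebra.
From mathcomp Require Import all_classical all_reals all_analysis.

Set Implicit Arguments.
Unset Strict Implicit.
Unset Printing Implicit Defensive.

Import Order.TTheory GRing.Theory Num.Theory.

Local Open Scope classical_set_scope.
Local Open Scope ring_scope.

(* The library's metric on ['rV[R]_k] is the sup metric. *)
Definition eucl_dist (R : realType) (k : nat) (x y : 'rV[R]_k) : R :=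
  Num.sqrt (\sum_(j < k) (x ord0 j - y ord0 j) ^+ 2).

Definition unit_cube (R : realType) (k : nat) : set 'rV[R]_k :=
  [set x : 'rV[R]_k | forall j : 'I_k, 0 <= x ord0 j <= 1].

(* A function on the cube is represented by a function on all of R^k, of which
   only the values on the cube matter. *)
Definition coarse_lipschitz1 (R : realType) (k : nat) (T : metricType R)
    (eps : R) (f : 'rV[R]_k -> T) : Prop :=
  forall x y, unit_cube x -> unit_cube y ->
    mdist (f x) (f y) <= eucl_dist x y + eps.

(* [0] is added to the set of distances so that the empty set has diameter [0]
   rather than [-oo]; an unbounded set has diameter [+oo]. *)
Definition diam (R : realType) (T : metricType R) (U : set T) : \bar R :=
  ereal_sup ([set 0%E] `|`
    [set (mdist p.1 p.2)%:E | p in [set p : T * T | U p.1 /\ U p.2]]).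

(* Finite covers are sequences padded with empty sets, which contribute [0]
   to the sum when [0 < k]. *)
Definition hcontent (R : realType) (T : metricType R) (k : nat) (E : set T) :
    \bar R :=
  ereal_inf [set (\sum_(0 <= i <oo) diam (U i) ^+ k)%E |
    U in [set U : nat -> set T | E `<=` \bigcup_i U i]].

(* Main.v *)
Require Import Defs.
From HB Require Import structures.
From mathcomp Require Import all_boot all_order all_algebra.
From mathcomp Require Import all_classical all_reals all_analysis.
From mathcomp Require Import zify ring lra.

Set Implicit Arguments.
Unset Strict Implicit.
Unset Printing Implicit Defensive.

Import Order.TTheory GRing.Theory Num.Theory.
Import numFieldNormedType.Exports.

Local Open Scope classical_set_scope.
Local Open Scope ring_scope.

(* McShane extension replaces [dist (f x) (f y)], up to [eps], by a
   pseudometric [d] on R^k that is exactly Lipschitz for the sup norm, and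
   folding makes it 2-periodic; from then on [eps] only decides at which dyadic
   levels anything has to be proved. For a vector [h] let [e_j] be the mean over
   the torus of [(d z (z + 2^j h) / 2^j)^2]. By the triangle inequality [e_j]
   decreases in [j], and the pointwise loss [deficit] controls how far the
   line through [z] with direction [h] is from being a constant speed geodesic
   at scale [2^j h]. The losses telescope over the dyadic levels, so the cubes
   near which some deficit is large (the non-flat ones) satisfy a Carleson
   packing condition. In a flat cube Q, long lines have almost constant speed;
   parallel long lines stay at bounded distance from each other, hence have
   almost the same speed. So if [d] contracts one pair of points of size about
   that of Q by [alpha], it contracts by about [alpha] in that direction on all
   of Q, and tubes in that direction show that the content of the image of Q is
   at most [C alpha |Q|]. The exceptional set consists of the maximal collapsed
   cubes and of the cubes with too many non-flat ancestors. A point outside it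
   meets boundedly many non-flat levels, and recording its position at these
   levels by a finite alphabet separates any two points that [d] contracts. *)

(** * Sup norm, folding, and sums over boxes *)

Section RowNorm.
Context {R : realType} {k : nat}.
Implicit Types x y : 'rV[R]_k.

Lemma norm_coord x j : `|x ord0 j| <= `|x|.
Proof.
rewrite [leRHS]/Num.Def.normr /= mx_normrE; apply/bigmax_geP; right => /=.
by exists (ord0, j).
Qed.

Lemma norm_le x (c : R) : 0 <= c -> (forall j, `|x ord0 j| <= c) -> `|x| <= c.
Proof.
move=> c0 xc; rewrite [leLHS]/Num.Def.normr /= mx_normrE (bigmax_le _ c0) //=.
by move=> [i j] _ /=; rewrite ord1.
Qed.

End RowNorm.

Lemma norm_max_coord (R : realType) (k : nat) (x : 'rV[R]_k.+1) :
  exists j, `|x| = `|x ord0 j|.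
Proof.
have [x0|x0] := eqVneq x 0; first by exists ord0; rewrite x0 normr0 mxE normr0.
have /mx_norm_neq0 [[i j]] : mx_norm x != 0 by rewrite -normr_eq0 in x0.
by rewrite /= ord1 => e; exists j.
Qed.

Section Fold.
Context {R : realType}.
Implicit Types t s : R.

(* The distance from [t] to the even integers. *)
Definition fold1 t : R := `|t - (2 * Num.floor ((t + 1) / 2))%:~R|.

(** The chosen even integer is within [1] of [t], so every other one is at distance at least [1].
    The Lipschitz bound and the periodicity follow from this minimality. *)
Lemma fold1_le t (m : int) : fold1 t <= `|t - (2 * m)%:~R|.
Proof.
rewrite /fold1; set q := Num.floor _.
have /andP[] := floor_itv ((t + 1) / 2); rewrite -/q !intrM intrD => q1 q2.
have [<-//|mq] := eqVneq q m.
have : (q%:~R + 1 <= m%:~R :> R) \/ (m%:~R + 1 <= q%:~R :> R).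
  rewrite -[1]/(1%:~R) -!intrD !ler_int; lia.
have -> : (2 : int)%:~R = 2 :> R by [].
have h : `|t - 2 * q%:~R| <= 1 by rewrite ler_norml; apply/andP; split; lra.
case=> h'; apply: (le_trans h); [rewrite ler0_norm|rewrite ger0_norm]; lra.
Qed.

Lemma fold1_lip t s : `|fold1 t - fold1 s| <= `|t - s|.
Proof.
have h u v : fold1 u <= `|u - v| + fold1 v.
  apply: (le_trans (fold1_le u (Num.floor ((v + 1) / 2)))).
  rewrite /fold1; apply: le_trans (ler_normD _ _).
  by rewrite addrA subrK.
have := h t s; have := h s t; rewrite (distrC s t) => h1 h2.
by rewrite ler_norml; apply/andP; split; lra.
Qed.

Lemma fold1_periodic t (m : int) : fold1 (t + (2 * m)%:~R) = fold1 t.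
Proof.
apply/eqP; rewrite eq_le; apply/andP; split.
- apply: (le_trans (fold1_le _ (Num.floor ((t + 1) / 2) + m))).
  rewrite /fold1; set q := Num.floor _.
  by rewrite mulrDr [(2 * q + _)%:~R]intrD opprD addrACA subrr addr0.
- apply: (le_trans (fold1_le _ (Num.floor ((t + (2 * m)%:~R + 1) / 2) - m))).
  rewrite /fold1; set q := Num.floor _.
  by rewrite mulrBr intrB opprB [X in t + X]addrC addrA addrAC.
Qed.

Lemma fold1_id t : 0 <= t <= 1 -> fold1 t = t.
Proof.
move=> /andP[t0 t1]; have h : fold1 t <= t.
  by apply: (le_trans (fold1_le t 0)); rewrite mulr0 subr0 ger0_norm.
apply/eqP; rewrite eq_le h /= /fold1; set q := Num.floor _.
rewrite intrM; have -> : (2 : int)%:~R = 2 :> R by [].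
have [q0|q0] := leP q 0.
  have : q%:~R <= 0 :> R by rewrite lerz0.
  by move=> ?; rewrite ger0_norm; lra.
have : 1 <= q%:~R :> R by rewrite ler1z; lia.
by move=> ?; rewrite ler0_norm; lra.
Qed.

Definition fold {k} (x : 'rV[R]_k) : 'rV[R]_k := \row_j fold1 (x ord0 j).

Lemma fold_lip k (x y : 'rV[R]_k) : `|fold x - fold y| <= `|x - y|.
Proof.
apply: norm_le => // j; rewrite !mxE.
apply: (le_trans (fold1_lip _ _)).
by have := norm_coord (x - y) j; rewrite !mxE.
Qed.

Lemma fold_id k (x : 'rV[R]_k) : unit_cube x -> fold x = x.
Proof. by move=> xc; apply/rowP => j; rewrite mxE fold1_id. Qed.

Lemma fold_periodic k (x : 'rV[R]_k) (w : 'rV[int]_k) :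
  fold (x + 2 *: map_mx intr w) = fold x.
Proof.
apply/rowP => j; rewrite !mxE.
have -> : 2 * (w ord0 j)%:~R = (2 * w ord0 j)%:~R :> R by rewrite intrM. exact: fold1_periodic.
Qed.

End Fold.

Section LatticeSums.
Context {R : realType} {k : nat}.

Definition box m := {ffun 'I_k -> 'I_m}.

Definition pt m (a : box m) : 'rV[R]_k := \row_j (a j)%:R.

(** Division with remainder by [q] in each coordinate; it splits a fine grid along the cubes of a
    coarser level. *)
Lemma sum_box_digits (p q m : nat) (F : 'rV[R]_k -> R) : m = (p * q)%N ->
  \sum_(y : box m) F (pt y) =
  \sum_(a : box p) \sum_(s : box q) F (q%:R *: pt a + pt s).
Proof.
move=> ->; rewrite pair_big /=.
have lt_pq (a : 'I_p) (s : 'I_q) : (a * q + s < p * q)%N.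
  apply: (@leq_trans (a.+1 * q)); first by rewrite mulSnr ltn_add2l.
  by rewrite leq_mul2r ltn_ord orbT.
have q_gt0 (y : 'I_(p * q)) : (0 < q)%N by case: (q) y => //; rewrite muln0 => -[].
have divp (y : 'I_(p * q)) : (y %/ q < p)%N by rewrite ltn_divLR // (q_gt0 y).
have modq (y : 'I_(p * q)) : (y %% q < q)%N by rewrite ltn_mod (q_gt0 y).
pose to (c : box p * box q) : box (p * q) := [ffun j => Ordinal (lt_pq (c.1 j) (c.2 j))].
pose from (y : box (p * q)) : box p * box q :=
  ([ffun j => Ordinal (divp (y j))], [ffun j => Ordinal (modq (y j))]).
have toK : cancel to from.
  move=> [a s]; rewrite /from /to; congr (_, _); apply/ffunP => j;
    rewrite !ffunE; apply/val_inj; rewrite /= ?ffunE /=.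
    by rewrite divnMDl ?divn_small ?addn0 // (leq_ltn_trans _ (ltn_ord (s j))).
  by rewrite modnMDl modn_small.
have fromK : cancel from to.
  move=> y; apply/ffunP => j; rewrite !ffunE; apply/val_inj.
  by rewrite /= ?ffunE /= -divn_eq.
rewrite (reindex to) /=; last by exists from => ? _; [exact: toK|exact: fromK].
apply: eq_bigr => -[a s] _; congr F; apply/rowP => j.
by rewrite !mxE ffunE /= natrD natrM mulrC.
Qed.

(** Adding [w] and reducing modulo [m] permutes the box, and periodicity hides the reduction. This
    is the discrete form of translation invariance on the torus. *)
Lemma sum_box_shift (m : nat) (F : 'rV[R]_k -> R) (w : 'rV[int]_k) :
  (forall x (u : 'rV[int]_k), F (x + m%:R *: map_mx intr u) = F x) ->
  \sum_(y : box m) F (pt y + map_mx intr w) = \sum_(y : box m) F (pt y).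
Proof.
move=> per.
have m0 (y : 'I_m) : (m%:Z != 0) by case: (m) y => // -[].
have lt_m (y : 'I_m) (j : int) : (`|((y%:Z + j) %% m%:Z)%Z| < m)%N.
  have := ltz_pmod (y%:Z + j) (_ : 0 < m%:Z); have := modz_ge0 (y%:Z + j) (m0 y).
  have : 0 < m%:Z by case: (m) y => // -[].
  lia.
pose sh (y : box m) : box m := [ffun j => Ordinal (lt_m (y j) (w ord0 j))].
have sh_inj : injective sh.
  move=> y y' /ffunP e; apply/ffunP => j; apply/val_inj => /=.
  have /(congr1 val) := e j; rewrite !ffunE /= => h.
  have : ((y j)%:Z + w ord0 j = (y' j)%:Z + w ord0 j %[mod m%:Z])%Z.
    by have := modz_ge0 ((y j)%:Z + w ord0 j) (m0 (y j));
       have := modz_ge0 ((y' j)%:Z + w ord0 j) (m0 (y j)); lia.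
  move/eqP; rewrite eqz_modDr => /eqP.
  by rewrite !modz_small //; [case|rewrite !le0z_nat ltz_nat ltn_ord..].
rewrite [RHS](reindex_inj sh_inj) /=; apply: eq_bigr => y _.
rewrite -(per (pt (sh y)) (\row_j (((y j)%:Z + w ord0 j) %/ m%:Z)%Z)).
congr F; apply/rowP => j; rewrite !mxE !ffunE /=.
have := modz_ge0 ((y j)%:Z + w ord0 j) (m0 (y j)).
have := divz_eq ((y j)%:Z + w ord0 j) m.
set u := (_ %/ _)%Z; set v := (_ %% _)%Z => e v0.
have -> : (`|v|%N%:R : R) = v%:~R by rewrite -[RHS]ger0_norm ?ler0z // -intr_norm -abszE.
have -> : (y j)%:R + (w ord0 j)%:~R = ((y j)%:Z + w ord0 j)%:~R :> R by rewrite intrD.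
by rewrite e intrD intrM mulrC addrC.
Qed.

Lemma card_box m : #|{: box m}| = (m ^ k)%N.
Proof. by rewrite card_ffun !card_ord. Qed.

End LatticeSums.
Arguments box k m : clear implicits.

(** * Energy and deficit *)

Section Energy.
Context {R : realType} {k : nat}.
Variable d : 'rV[R]_k -> 'rV[R]_k -> R.
Hypothesis d_refl : forall x, d x x = 0.
Hypothesis d_sym : forall x y, d x y = d y x.
Hypothesis d_triangle : forall x y z, d x z <= d x y + d y z.
Hypothesis d_lip : forall x y, d x y <= `|x - y|.
Implicit Types (x y z h : 'rV[R]_k) (j : nat).

Lemma d_ge0 x y : 0 <= d x y.
Proof.
have := d_triangle x y x; rewrite d_refl (d_sym y x) => h; lra.
Qed.

Lemma d_quad x y x' y' : `|d x y - d x' y'| <= `|x - x'| + `|y - y'|.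
Proof.
have := d_triangle x x' y; have := d_triangle x' y' y.
have := d_triangle x' x y'; have := d_triangle x y y'.
have := d_lip x x'; have := d_lip y y'; rewrite (d_sym x' x) (d_sym y' y).
move=> *; rewrite ler_norml; apply/andP; split; lra.
Qed.

Definition rate h j z : R := d z (z + 2 ^+ j *: h) / 2 ^+ j.

(* Up to the triangle inequality, the variance of the rates of the two halves
   of the segment from [z] to [z + 2 ^+ j.+1 *: h]. *)
Definition deficit h j z : R :=
  (rate h j z ^+ 2 + rate h j (z + 2 ^+ j *: h) ^+ 2) / 2 - rate h j.+1 z ^+ 2.

Let p2_gt0 j : 0 < 2 ^+ j :> R. Proof. by rewrite exprn_gt0. Qed.

Lemma rate_ge0 h j z : 0 <= rate h j z.
Proof. by rewrite divr_ge0 ?d_ge0 // ltW. Qed.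

Lemma rate_le h j z : rate h j z <= `|h|.
Proof.
rewrite ler_pdivrMr //; apply: (le_trans (d_lip _ _)).
rewrite opprD addrA subrr add0r normrN normrZ (ger0_norm (ltW (p2_gt0 j))).
by rewrite mulrC.
Qed.

Lemma rateS_le h j z :
  rate h j.+1 z <= (rate h j z + rate h j (z + 2 ^+ j *: h)) / 2.
Proof.
rewrite /rate -mulrDl -mulrA -invfM -[2 ^+ j * 2]exprSr.
rewrite ler_pM2r ?invr_gt0 //.
have := d_triangle z (z + 2 ^+ j *: h) (z + 2 ^+ j.+1 *: h).
by rewrite -addrA -scalerDl exprS mulr2n mulrDl mul1r.
Qed.

Lemma rate_lip h j z z' : `|rate h j z - rate h j z'| <= 2 * `|z - z'| / 2 ^+ j.
Proof.
rewrite /rate -mulrBl normrM normfV (ger0_norm (ltW (p2_gt0 j))).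
rewrite ler_pM2r ?invr_gt0 //; apply: (le_trans (d_quad _ _ _ _)).
rewrite opprD addrACA subrr addr0; lra.
Qed.

Lemma deficit_ge0 h j z : 0 <= deficit h j z.
Proof.
rewrite /deficit.
have := rate_ge0 h j.+1 z; have := rateS_le h j z.
set a := rate _ j z; set b := rate _ j _; set c := rate _ _ _ => h1 h2.
have h3 : c ^+ 2 <= ((a + b) / 2) ^+ 2 by rewrite ler_pXn2r ?nnegrE //; lra.
have := sqr_ge0 (a - b); lra.
Qed.

(** With [a], [b] the rates of the halves, [m] their mean and [c] the rate of the whole, the deficit
    is $((a-b)/2)^2 + (m^2-c^2)$. Since $0\le c\le m$, both terms are nonnegative and $(m-c)^2\le
    m^2-c^2$; each square costs one [e]. *)
Lemma rateS_close h j z e : 0 <= e -> deficit h j z <= e ^+ 2 ->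
  `|rate h j.+1 z - rate h j z| <= 2 * e.
Proof.
rewrite /deficit; have := rate_ge0 h j.+1 z; have := rateS_le h j z.
set a := rate _ j z; set b := rate _ j _; set c := rate _ _ _ => h1 h2 e0 h3.
have h4 : ((a - b) / 2) ^+ 2 <= e ^+ 2.
  have : c ^+ 2 <= ((a + b) / 2) ^+ 2 by rewrite ler_pXn2r ?nnegrE //; lra.
  lra.
have h5 : ((a + b) / 2 - c) ^+ 2 <= e ^+ 2.
  have : 0 <= c * ((a + b) / 2 - c) by rewrite mulr_ge0 //; lra.
  have := sqr_ge0 (a - b); lra.
move: h4; rewrite -ler_sqrt ?sqr_ge0 // !sqrtr_sqr (ger0_norm e0) ler_norml.
move: h5; rewrite -ler_sqrt ?sqr_ge0 // !sqrtr_sqr (ger0_norm e0) ler_norml.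
move=> /andP[? ?] /andP[? ?]; rewrite ler_norml; apply/andP; split; lra.
Qed.

Lemma rate_close h z e i J : 0 <= e -> (i <= J)%N ->
  (forall j, (j < J)%N -> deficit h j z <= e ^+ 2) ->
  `|rate h J z - rate h i z| <= J%:R * (2 * e).
Proof.
move=> e0; elim: J => [|J IH].
  by rewrite leqn0 => /eqP -> _; rewrite subrr normr0 mul0r.
rewrite leq_eqVlt => /orP[/eqP -> _|iJ dJ].
  by rewrite subrr normr0 !mulr_ge0.
rewrite -natr1 mulrDl mul1r -(subrKA (rate h J z)).
apply: (le_trans (ler_normD _ _)); rewrite [leRHS]addrC.
apply: lerD; first by apply: rateS_close => //; exact: dJ.
by rewrite IH // => j jJ; rewrite dJ // ltnW.
Qed.

(** Rates are at most [B] and change by at most [2 * s], so each square changes by at most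
    [4 * B * s]. A large deficit at one point thus persists on a small subcube, where a sampling
    grid can see it. *)
Lemma deficit_lip h j z y B s : `|h| <= B -> `|z - y| <= s ->
  deficit h j z - 8 * B * s <= deficit h j y.
Proof.
move=> hB zys.
have r j' z' y' : `|z' - y'| <= s ->
    `|rate h j' z' ^+ 2 - rate h j' y' ^+ 2| <= 4 * B * s.
  move=> zy'; have hr : `|rate h j' z' - rate h j' y'| <= 2 * s.
    apply: (le_trans (rate_lip _ _ _ _)); rewrite ler_pdivrMr //.
    have p1 : 1 <= 2 ^+ j' :> R by rewrite exprn_ege1 ?ler1n.
    have s0 := le_trans (normr_ge0 _) zy'.
    by have := ler_peMr s0 p1; lra.
  rewrite subr_sqr normrM.
  have -> : 4 * B * s = (2 * s) * (B + B) by ring.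
  apply: ler_pM => //; rewrite ger0_norm ?addr_ge0 ?rate_ge0 //.
  by apply: lerD; apply: (le_trans (rate_le _ _ _)).
rewrite /deficit.
have := r j z y zys; have := r j.+1 z y zys.
have := r j (z + 2 ^+ j *: h) (y + 2 ^+ j *: h).
rewrite opprD addrACA subrr addr0 => /(_ zys).
rewrite !ler_norml => /andP[? ?] /andP[? ?] /andP[? ?]; lra.
Qed.

End Energy.

(** Sample points of mesh $2^{-G}$ in one period $[0,2)^k$; sums over them replace integrals over
    the torus. *)
Definition grid {R : realType} {k} G (y : box k (2 ^ G.+1)) : 'rV[R]_k :=
  2 ^- G *: pt y.
Arguments grid {R k} G y.

Definition step {R : realType} {k} c n (v : 'rV[int]_k) : 'rV[R]_k :=
  2 ^- (n + c) *: map_mx intr v.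

Section EnergySum.
Context {R : realType} {k : nat}.
Variable d : 'rV[R]_k -> 'rV[R]_k -> R.
Hypothesis d_refl : forall x, d x x = 0.
Hypothesis d_sym : forall x y, d x y = d y x.
Hypothesis d_triangle : forall x y z, d x z <= d x y + d y z.
Hypothesis d_lip : forall x y, d x y <= `|x - y|.
Hypothesis d_periodic : forall x y (u : 'rV[int]_k),
  d (x + 2 *: map_mx intr u) (y + 2 *: map_mx intr u) = d x y.

Lemma rate_periodic h j x (u : 'rV[int]_k) :
  rate d h j (x + 2 *: map_mx intr u) = rate d h j x.
Proof. by rewrite /rate addrAC d_periodic. Qed.

Lemma deficit_periodic h j x (u : 'rV[int]_k) :
  deficit d h j (x + 2 *: map_mx intr u) = deficit d h j x.
Proof. by rewrite /deficit addrAC !rate_periodic. Qed.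

Lemma sum_grid_shift G (F : 'rV[R]_k -> R) (w : 'rV[int]_k) :
  (forall x (u : 'rV[int]_k), F (x + 2 *: map_mx intr u) = F x) ->
  \sum_y F (grid G y + 2 ^- G *: map_mx intr w) = \sum_y F (grid G y).
Proof.
move=> per.
rewrite -(@sum_box_shift _ _ _ (fun x => F (2 ^- G *: x)) w).
  by apply: eq_bigr => y _; rewrite scalerDr.
move=> x u; rewrite scalerDr scalerA natrX exprSr mulrA mulVf ?mul1r ?per //.
Qed.

Definition energy G c n j (v : 'rV[int]_k) : R :=
  \sum_y (rate d (step c n v) j (grid G y) * 2 ^+ (n + c)) ^+ 2.

(** Raising the level halves the step and raising [j] doubles the multiple, so the segment is
    unchanged; this makes the losses of consecutive levels telescope. *)
Lemma energyS G c n j v : energy G c n.+1 j.+1 v = energy G c n j v.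
Proof.
apply: eq_bigr => y _; congr (_ ^+ _); rewrite /rate /step !scalerA addSn.
have -> : 2 ^+ j.+1 / 2 ^+ (n + c).+1 = 2 ^+ j / 2 ^+ (n + c) :> R.
  by rewrite !exprS invfM mulrACA divff // mul1r.
rewrite -!mulrA; congr (_ * _).
by rewrite !exprS invfM mulrACA mulVf // mul1r.
Qed.

Lemma energy_le G c n j v b : `|map_mx intr v : 'rV[R]_k| <= b ->
  energy G c n j v <= (2 ^ (G.+1 * k))%:R * b ^+ 2.
Proof.
move=> vb; have b0 := le_trans (normr_ge0 _) vb.
have -> : (2 ^ (G.+1 * k))%:R * b ^+ 2 = \sum_(y : box k (2 ^ G.+1)) b ^+ 2.
  by rewrite sumr_const card_box mulr_natl expnM.
apply: ler_sum => y _.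
have p2_gt0 m : 0 < 2 ^+ m :> R by rewrite exprn_gt0.
have r0 := rate_ge0 d_refl d_sym d_triangle (step c n v) j (grid G y).
rewrite ler_pXn2r ?nnegrE ?(mulr_ge0 r0) ?(ltW (p2_gt0 _)) //.
rewrite -ler_pdivlMr //; apply: (le_trans (rate_le _ _ _ _)) => //.
rewrite normrZ normfV (ger0_norm (ltW (p2_gt0 _))) mulrC.
by rewrite ler_pM2r ?invr_gt0.
Qed.

Lemma sum_deficit G c n j v : (n + c <= G)%N ->
  \sum_y deficit d (step c n v) j (grid G y) * (2 ^+ (n + c)) ^+ 2 =
  energy G c n j v - energy G c n j.+1 v.
Proof.
move=> ncG; rewrite /deficit -mulr_suml sumrB -mulr_suml big_split /=.
(* The second half of each segment starts at a grid translate of the first, so its squared rates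
   have the same sum. *)
have -> : \sum_y rate d (step c n v) j (grid G y + 2 ^+ j *: step c n v) ^+ 2 =
   \sum_y rate d (step c n v) j (grid G y) ^+ 2.
  rewrite -[RHS](@sum_grid_shift _ (fun x => rate d (step c n v) j x ^+ 2)
     ((2 ^+ (j + (G - (n + c)))) *: v)); last first.
    by move=> x u; rewrite rate_periodic.
  apply: eq_bigr => y _; congr (rate _ _ _ (_ + _) ^+ 2).
  rewrite /step map_mxZ /= !scalerA; congr (_ *: _).
  have -> : 2 ^- G = (2 ^+ (G - (n + c)) * 2 ^+ (n + c))^-1 :> R.
    by rewrite -exprD subnK.
  have -> : (2 ^+ (j + (G - (n + c))) : int)%:~R = 2 ^+ j * 2 ^+ (G - (n + c)) :> R.
    by rewrite rmorphXn /= -exprD.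
  set a := 2 ^+ (G - _); set b := 2 ^+ (n + c).
  have a0 : a != 0 by rewrite expf_neq0.
  have b0 : b != 0 by rewrite expf_neq0.
  by field; apply/andP.
set S := \sum_y _; have -> : (S + S) / 2 = S by field.
rewrite /S /energy mulrBl !mulr_suml.
by congr (_ - _); apply: eq_bigr => y _; rewrite -exprMn.
Qed.

(** After telescoping only the energy at level [N] remains, so the bound does not grow with the
    number of levels. *)
Lemma sum_levels_deficit G c N j v b : (N + c <= G)%N ->
  `|map_mx intr v : 'rV[R]_k| <= b ->
  \sum_(n < N) \sum_y deficit d (step c n v) j (grid G y) * (2 ^+ (n + c)) ^+ 2
  <= (2 ^ (G.+1 * k))%:R * b ^+ 2.
Proof.
move=> NG vb.
rewrite (eq_bigr (fun n : 'I_N => energy G c n.+1 j.+1 v - energy G c n j.+1 v));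
  last first.
  move=> n _; rewrite sum_deficit ?energyS //.
  by rewrite (leq_trans _ NG) // leq_add2r ltnW.
rewrite -(big_mkord xpredT (fun n => energy G c n.+1 j.+1 v - energy G c n j.+1 v)).
rewrite telescope_sumr //; apply: le_trans (energy_le _ c N j.+1 vb).
by rewrite gerBl sumr_ge0 // => y _; rewrite sqr_ge0.
Qed.

End EnergySum.

(** * Dyadic cubes and the packing of non-flat cubes *)

Section DyadicCubes.
Context {R : realType} {k : nat}.
Implicit Types (x y z : 'rV[R]_k) (n m : nat).

(** A half-open dyadic cube of side $2^{-n}$ is named by its integer vector; [cube n x = cube n y]
    says that the two points share one. *)
Definition cube n x : 'rV[int]_k := \row_j Num.floor (2 ^+ n * x ord0 j).

Definition corner n x : 'rV[R]_k := 2 ^- n *: map_mx intr (cube n x).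

Lemma expr2_gt0 n : 0 < 2 ^+ n :> R. Proof. by rewrite exprn_gt0. Qed.

Lemma expr2_neq0 n : 2 ^+ n != 0 :> R. Proof. by rewrite gt_eqF ?expr2_gt0. Qed.

Lemma cubeP n x (u : 'rV[int]_k) :
  (forall j, (u ord0 j)%:~R <= 2 ^+ n * x ord0 j < (u ord0 j + 1)%:~R) ->
  cube n x = u.
Proof. by move=> h; apply/rowP => j; rewrite mxE; exact: floor_def. Qed.

Lemma cube_itv n x j :
  (cube n x ord0 j)%:~R <= 2 ^+ n * x ord0 j < (cube n x ord0 j + 1)%:~R.
Proof. by rewrite mxE floor_itv. Qed.

Lemma cube_anti n m x y : (m <= n)%N -> cube n x = cube n y ->
  cube m x = cube m y.
Proof.
move=> /subnK <- /rowP e; apply/rowP => j; have := e j; rewrite !mxE.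
move: (n - m)%N (x ord0 j) (y ord0 j) => {x y e n j} e s t h.
have key r q : (q <= Num.floor (2 ^+ m * r)) =
    (2 ^+ e * q <= Num.floor (2 ^+ (e + m) * r :> R)).
  rewrite !floor_ge_int intrM rmorphXn /= exprD -mulrA.
  by rewrite ler_pM2l // expr2_gt0.
by apply/eqP; rewrite eq_le; apply/andP; split;
  [rewrite key -h -key|rewrite key h -key].
Qed.

Lemma cube_lattice n (u : 'rV[int]_k) : cube n (2 ^- n *: map_mx intr u) = u.
Proof.
apply: cubeP => j; rewrite !mxE mulrA mulfV ?expr2_neq0 // mul1r lexx /=.
by rewrite ltr_int; lia.
Qed.

Lemma corner_dist n x : `|x - corner n x| <= 2 ^- n.
Proof.
apply: norm_le => [|j]; first by rewrite invr_ge0 ltW ?expr2_gt0.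
have /andP[] := cube_itv n x j; rewrite !mxE; set q := Num.floor _ => q1 q2.
have -> : x ord0 j - 2 ^- n * q%:~R = (2 ^+ n * x ord0 j - q%:~R) / 2 ^+ n.
  by rewrite mulrBl [2 ^+ n * _]mulrC mulfK ?expr2_neq0 // [q%:~R / _]mulrC.
rewrite normrM [`|_^-1|]ger0_norm ?invr_ge0 ?(ltW (expr2_gt0 _)) //.
rewrite -[leRHS]mul1r ler_pM2r ?invr_gt0 ?expr2_gt0 //.
by move: q2; rewrite intrD => q2; rewrite ger0_norm; lra.
Qed.

Lemma pt_int m (a : box k m) : pt a = map_mx intr (\row_j (a j)%:Z) :> 'rV[R]_k.
Proof. by apply/rowP => j; rewrite !mxE. Qed.

Lemma cube_grid n (a : box k (2 ^ n.+1)) :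
  cube n (grid n a : 'rV[R]_k) = \row_j (a j)%:Z.
Proof. by rewrite /grid pt_int cube_lattice. Qed.

Lemma sum_grid_digits n G (F : 'rV[R]_k -> R) : (n <= G)%N ->
  \sum_y F (grid G y) =
  \sum_a \sum_(s : box k (2 ^ (G - n))) F (grid n a + 2 ^- G *: pt s).
Proof.
move=> nG.
rewrite (@sum_box_digits _ _ (2 ^ n.+1) (2 ^ (G - n)) _
  (fun x => F (2 ^- G *: x))); last by rewrite -expnD addSn subnKC.
apply: eq_bigr => a _; apply: eq_bigr => s _; congr F.
rewrite scalerDr scalerA; congr (_ *: _ + _); rewrite natrX.
have -> : 2 ^- G = (2 ^+ (G - n) * 2 ^+ n)^-1 :> R by rewrite -exprD subnK.
by rewrite invfM mulrAC mulVf ?expr2_neq0 // mul1r.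
Qed.

Lemma sum_grid_cubes n G (F : 'rV[R]_k -> R) : (n <= G)%N ->
  (forall x y, cube n x = cube n y -> F x = F y) ->
  \sum_y F (grid G y) = (2 ^ ((G - n) * k))%:R * \sum_a F (grid n a).
Proof.
move=> nG Fc; rewrite (sum_grid_digits _ nG) mulr_sumr; apply: eq_bigr => a _.
rewrite (eq_bigr (fun=> F (grid n a))).
  by rewrite sumr_const card_box mulr_natl expnM.
move=> s _; apply: Fc; rewrite cube_grid; apply: cubeP => j; rewrite !mxE.
rewrite mulrDr !mulrA mulfV ?expr2_neq0 // mul1r.
have -> : 2 ^+ n / 2 ^+ G = 2 ^- (G - n) :> R.
  rewrite -{1}(subnK nG) exprD invfM mulrCA mulfV ?expr2_neq0 // mulr1.
  by [].
rewrite intrD lerDl ltrD2l mulr_ge0 ?invr_ge0 ?(ltW (expr2_gt0 _)) //=.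
rewrite mulrC ltr_pdivrMr ?expr2_gt0 // mul1r -natrX ltr_nat.
exact: ltn_ord.
Qed.

(** Finite enumeration of the integer vectors of sup norm at most [L], which allows sums over
    directions and over offsets of cubes. *)
Definition ivec L (o : box k (2 * L).+1) : 'rV[int]_k := \row_j ((o j)%:Z - L%:Z).

Lemma ivec_surj L (w : 'rV[int]_k) : (forall j, `|w ord0 j| <= L%:Z) ->
  exists o, w = @ivec L o.
Proof.
move=> h; have lt j : (`|(w ord0 j + L%:Z)%R| < (2 * L).+1)%N by have := h j; lia.
exists [ffun j => Ordinal (lt j)]; apply/rowP => j; rewrite !mxE ffunE /=.
have hj : `|w ord0 j : int| <= L%:Z := h j.
by change (w ord0 j = (absz (w ord0 j + L%:Z)%R)%:Z - L%:Z :> int); lia.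
Qed.

Lemma ivec_norm L (o : box k (2 * L).+1) :
  `|map_mx intr (ivec o) : 'rV[R]_k| <= L%:R.
Proof.
apply: norm_le => // j; rewrite !mxE -intr_norm -[L%:R]/(L%:Z%:~R) ler_int.
by have := ltn_ord (o j); lia.
Qed.

End DyadicCubes.

(** The radius of ten sides leaves room for lines that leave the cube. The factor $(2^{n+c})^2$
    makes the condition scale invariant, and [x] enters through its cube only. *)
Definition flat {R : realType} {k} (d : 'rV[R]_k -> 'rV[R]_k -> R)
    (c b J : nat) (tau : R) n x : Prop :=
  forall z (v : 'rV[int]_k) j, `|z - corner n x| <= 10 / 2 ^+ n ->
    `|map_mx intr v : 'rV[R]_k| <= b%:R -> (j < J)%N ->
    deficit d (step c n v) j z * (2 ^+ (n + c)) ^+ 2 <= tau.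

Lemma flat_cube (R : realType) k (d : 'rV[R]_k -> 'rV[R]_k -> R) c b J tau n x y :
  cube n x = cube n y -> flat d c b J tau n x -> flat d c b J tau n y.
Proof. by rewrite /flat /corner => ->. Qed.

Section Packing.
Context {R : realType} {k : nat}.
Variables (c b J : nat) (tau : R).
Hypothesis tau_gt0 : 0 < tau.
Variable d : 'rV[R]_k -> 'rV[R]_k -> R.
Hypothesis d_refl : forall x, d x x = 0.
Hypothesis d_sym : forall x y, d x y = d y x.
Hypothesis d_triangle : forall x y z, d x z <= d x y + d y z.
Hypothesis d_lip : forall x y, d x y <= `|x - y|.
Hypothesis d_periodic : forall x y (u : 'rV[int]_k),
  d (x + 2 *: map_mx intr u) (y + 2 *: map_mx intr u) = d x y.
Variable rho : nat.
Hypothesis rho_large : 16 * b%:R * 2 ^+ c <= tau * 2 ^+ rho.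

(** Deficits are nonnegative, so this single function dominates each of them and detects every
    failure of flatness. *)
Definition total_deficit n x : R := \sum_(o : box k (2 * b).+1) \sum_(j < J)
  deficit d (step c n (ivec o)) j x * (2 ^+ (n + c)) ^+ 2.

Let total_ge n x (o : box k (2 * b).+1) (j : 'I_J) :
  deficit d (step c n (ivec o)) j x * (2 ^+ (n + c)) ^+ 2 <= total_deficit n x.
Proof.
have ge0 o' (j' : 'I_J) :
    0 <= deficit d (step c n (@ivec k b o')) j' x * (2 ^+ (n + c)) ^+ 2.
  by rewrite mulr_ge0 ?sqr_ge0 // deficit_ge0.
rewrite /total_deficit (bigD1 o) //= (bigD1 j) //= -addrA lerDl.
by rewrite addr_ge0 ?sumr_ge0 // => o' _; rewrite sumr_ge0.
Qed.

Let total_ge0 n x : 0 <= total_deficit n x.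
Proof.
rewrite sumr_ge0 // => o _; rewrite sumr_ge0 // => j _.
by rewrite mulr_ge0 ?sqr_ge0 // deficit_ge0.
Qed.

(** Ten sides of a level [n] cube are [10 * 2 ^ rho] subcubes of level [n + rho]; the surplus
    absorbs the rounding. *)
Let L := (11 * 2 ^ rho)%N.

(** Some deficit exceeds [tau] at a point [z], and by [rho_large] it varies by at most [tau / 2] on
    the subcube of level [n + rho] containing [z]. The witness is the offset of that subcube from
    the corner. *)
Lemma nonflat_witness n x : ~ flat d c b J tau n x ->
  exists o : box k (2 * L).+1, forall t : 'rV[R]_k,
    (forall j, 0 <= t ord0 j <= 2 ^- (n + rho)) ->
    tau / 2 <= total_deficit n (corner n x + t + 2 ^- (n + rho) *: map_mx intr (ivec o)).
Proof.
move=> /existsNP[z /existsNP[v /existsNP[j /not_implyP[zx /not_implyP[vb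
  /not_implyP[jJ /negP]]]]]]; rewrite -ltNge => hz.
have p2 m := expr2_gt0 (R := R) m.
have [w ow] : exists o : box k (2 * L).+1,
    cube (n + rho) z - 2 ^+ rho *: cube n x = ivec o.
  apply: ivec_surj => i.
  have := le_trans (norm_coord _ i) zx; rewrite ler_pdivlMr //.
  rewrite -[X in _ * X]ger0_norm ?(ltW (p2 _)) // -normrM ler_norml => /andP[z1 z2].
  have /andP[] := cube_itv (n + rho) z i.
  move: z1 z2; rewrite !mxE; set q := Num.floor (2 ^+ n * _).
  set r := Num.floor _ => z1 z2; rewrite intrD.
  have r1 : 1 <= 2 ^+ rho :> R by rewrite exprn_ege1 ?ler1n.
  have -> : 2 ^+ (n + rho) * z ord0 i =
      (z ord0 i - 2 ^- n * q%:~R) * 2 ^+ n * 2 ^+ rho + 2 ^+ rho * q%:~R.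
    rewrite mulrBl mulrAC mulVf ?expr2_neq0 // exprD; ring.
  move: z1 z2; set A := _ * 2 ^+ n => z1 z2 r2 r3.
  have z1' : - 10 * 2 ^+ rho <= A * 2 ^+ rho by rewrite ler_pM2r //; lra.
  have z2' : A * 2 ^+ rho <= 10 * 2 ^+ rho by rewrite ler_pM2r //; lra.
  rewrite -(ler_int R) intr_norm intrB intrM rmorphXn /=.
  have -> : L%:Z%:~R = 11 * 2 ^+ rho :> R by rewrite -[LHS]/(L%:R) natrM natrX.
  by rewrite ler_norml; apply/andP; split; lra.
have [v' vv'] : exists o : box k (2 * b).+1, v = ivec o.
  apply: ivec_surj => i; have := le_trans (norm_coord _ i) vb.
  by rewrite mxE -intr_norm -[b%:R]/(b%:Z%:~R) ler_int.
exists w => t t01; apply: le_trans (total_ge _ _ v' (Ordinal jJ)).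
rewrite -vv' /=; set y := _ + _ + _.
have zy : `|z - y| <= 2 ^- (n + rho).
  apply: norm_le => [|i]; first by rewrite invr_ge0 ltW.
  have /andP[t1 t2] := t01 i; have /andP[z1 z2] := cube_itv (n + rho) z i.
  have -> : (z - y) ord0 i = z ord0 i - y ord0 i by rewrite !mxE.
  have -> : y ord0 i = t ord0 i + (cube (n + rho) z ord0 i)%:~R / 2 ^+ (n + rho).
    rewrite /y -ow /corner !mxE intrB intrM rmorphXn /= exprD invfM.
    by field; rewrite ?expr2_neq0.
  move: z1 z2; set r := cube _ _ _ _ => z1 z2.
  rewrite -ler_pdivrMl // in z1; rewrite mulrC intrD -ltr_pdivlMr // mulrDl mul1r in z2.
  rewrite [_^-1 * _]mulrC in z1.
  by rewrite ler_norml; apply/andP; split; lra.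
have vs : `|step c n v : 'rV[R]_k| <= b%:R / 2 ^+ (n + c).
  rewrite normrZ normfV (ger0_norm (ltW (p2 _))) mulrC.
  by rewrite ler_pM2r ?invr_gt0.
have := deficit_lip d_refl d_sym d_triangle d_lip j vs zy.
rewrite -(ler_pM2r (x := (2 ^+ (n + c)) ^+ 2)) ?exprn_gt0 // mulrBl.
apply: le_trans.
suff : 8 * (b%:R / 2 ^+ (n + c)) / 2 ^+ (n + rho) * (2 ^+ (n + c)) ^+ 2 <= tau / 2.
  by move: hz; set D := deficit _ _ _ _ * _; lra.
have -> : 8 * (b%:R / 2 ^+ (n + c)) / 2 ^+ (n + rho) * (2 ^+ (n + c)) ^+ 2 =
   8 * b%:R * 2 ^+ c / 2 ^+ rho :> R.
  by rewrite !exprD; field; rewrite !expr2_neq0.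
by rewrite ler_pdivrMr //; move: rho_large; lra.
Qed.

Let total_periodic n x (u : 'rV[int]_k) :
  total_deficit n (x + 2 *: map_mx intr u) = total_deficit n x.
Proof.
by apply: eq_bigr => o _; apply: eq_bigr => j _; rewrite deficit_periodic.
Qed.

(** Chebyshev with double counting: each of the $(2L+1)^k$ translates of [total_deficit] has the
    same sum, and for a non-flat cube one of them is at least [tau / 2] on the whole subcube at its
    corner. *)
Lemma nonflat_level n G : (n + rho <= G)%N ->
  \sum_(a : box k (2 ^ n.+1)) `[< ~ flat d c b J tau n (grid n a) >]%:R
     * (tau / 2) * (2 ^ ((G - (n + rho)) * k))%:R
  <= ((2 * L).+1 ^ k)%:R * \sum_y total_deficit n (grid G y).
Proof.
move=> nG; have nG' : (n <= G)%N by rewrite (leq_trans _ nG) ?leq_addr.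
pose T (o : box k (2 * L).+1) x :=
  total_deficit n (x + 2 ^- (n + rho) *: map_mx intr (ivec o)).
have -> : ((2 * L).+1 ^ k)%:R * \sum_y total_deficit n (grid G y) =
    \sum_o \sum_y T o (grid G y).
  rewrite [RHS](eq_bigr (fun=> \sum_y total_deficit n (grid G y))).
    by rewrite sumr_const card_box mulr_natl.
  move=> o _; rewrite -[RHS](@sum_grid_shift _ _ _ _ (2 ^+ (G - (n + rho)) *: ivec o)) //.
  apply: eq_bigr => y _; congr (total_deficit _ (_ + _)).
  rewrite map_mxZ /= scalerA rmorphXn /=; congr (_ *: _).
  have -> : 2 ^- G = (2 ^+ (G - (n + rho)) * 2 ^+ (n + rho))^-1 :> R.
    by rewrite -exprD subnK.
  have -> : (2 : int)%:~R = 2 :> R by [].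
  by field; rewrite !expr2_neq0.
have T0 o x : 0 <= T o x by exact: total_ge0.
rewrite (eq_bigr (fun o => \sum_(a : box k (2 ^ n.+1))
  \sum_(s : box k (2 ^ (G - n))) T o (grid n a + 2 ^- G *: pt s))); last first.
  by move=> o _; rewrite (sum_grid_digits _ nG').
rewrite exchange_big; apply: ler_sum => a _ /=.
case: asboolP => [|_]; last by rewrite !mul0r !sumr_ge0 // => *; rewrite sumr_ge0.
move=> /nonflat_witness[w ho]; rewrite mul1r (bigD1 w) //= -[leLHS]addr0 lerD //; last first.
  by rewrite sumr_ge0 // => *; rewrite sumr_ge0.
rewrite (@sum_box_digits _ _ (2 ^ rho) (2 ^ (G - (n + rho))) _
  (fun x => T w (grid n a + 2 ^- G *: x))); last first.
  by rewrite -expnD; congr (2 ^ _)%N; lia.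
have lt0 : (0 < 2 ^ rho)%N by rewrite expn_gt0.
(* The digit zero selects the subcube at the corner; the other subcubes are discarded. *)
rewrite (bigD1 [ffun=> Ordinal lt0]) //= -[leLHS]addr0 lerD //; last first.
  by rewrite sumr_ge0 // => *; rewrite sumr_ge0.
have -> : tau / 2 * (2 ^ ((G - (n + rho)) * k))%:R =
    \sum_(s : box k (2 ^ (G - (n + rho)))) tau / 2.
  by rewrite sumr_const card_box mulr_natr expnM.
apply: ler_sum => s _; rewrite /T.
have -> : grid n a = corner n (grid n a) :> 'rV[R]_k.
  by rewrite /corner cube_grid /grid pt_int.
apply: ho => j; rewrite !mxE ffunE mulr0 add0r.
have p2 m := expr2_gt0 (R := R) m.
rewrite mulr_ge0 ?invr_ge0 ?(ltW (p2 _)) //= mulrC ler_pdivrMr //.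
have -> : 2 ^+ G = 2 ^+ (n + rho) * 2 ^+ (G - (n + rho)) :> R.
  by rewrite -exprD subnKC.
by rewrite mulKf ?expr2_neq0 // -natrX ler_nat ltnW.
Qed.

Lemma nonflat_packing N :
  \sum_(n < N) \sum_(a : box k (2 ^ n.+1))
     `[< ~ flat d c b J tau n (grid n a) >]%:R / (2 ^ (n * k))%:R
  <= 2 / tau * (2 ^ (rho * k))%:R * ((2 * L).+1 ^ k)%:R
     * ((2 * b).+1 ^ k)%:R * J%:R * (2 ^ k)%:R * b%:R ^+ 2.
Proof.
(* One grid fine enough for the steps and subcubes of the first [N] levels; its number of points
   cancels in the end. *)
pose G := (N + c + rho)%N.
have G0 : 0 < (2 ^ (G * k))%:R :> R by rewrite ltr0n expn_gt0.
have t0 := tau_gt0.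
have r0 : 0 < (2 ^ (rho * k))%:R :> R by rewrite ltr0n expn_gt0.
pose c0 : R := tau / 2 * ((2 ^ (G * k))%:R / (2 ^ (rho * k))%:R).
have c0_gt0 : 0 < c0 by rewrite !mulr_gt0 ?invr_gt0.
have total_le : \sum_(n < N) \sum_y total_deficit n (grid G y) <=
    ((2 * b).+1 ^ k)%:R * (J%:R * ((2 ^ (G.+1 * k))%:R * b%:R ^+ 2)).
  rewrite (eq_bigr (fun n : 'I_N => \sum_(o : box k (2 * b).+1) \sum_(j < J)
     \sum_y deficit d (step c n (ivec o)) j (grid G y) * (2 ^+ (n + c)) ^+ 2));
    last first.
    move=> n _; rewrite exchange_big; apply: eq_bigr => o _ /=.
    by rewrite exchange_big.
  have sum_le (o : box k (2 * b).+1) j := @sum_levels_deficit R k d d_refl d_sym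
    d_triangle d_lip d_periodic G c N j (ivec o) _ (leq_addr _ _) (ivec_norm o).
  move: ((2 ^ (G.+1 * k))%:R * b%:R ^+ 2) sum_le => A sum_le.
  have -> : ((2 * b).+1 ^ k)%:R * (J%:R * A) =
      \sum_(o : box k (2 * b).+1) \sum_(j < J) A.
    by rewrite sumr_const card_box sumr_const card_ord mulr_natl mulr_natl.
  rewrite exchange_big; apply: ler_sum => o _.
  rewrite exchange_big; apply: ler_sum => j _.
  exact: sum_le.
rewrite -(ler_pM2l c0_gt0) mulr_sumr.
apply: (@le_trans _ _ (((2 * L).+1 ^ k)%:R *
   \sum_(n < N) \sum_y total_deficit n (grid G y))).
  rewrite mulr_sumr; apply: ler_sum => n _.
  have nG : (n + rho <= G)%N by have := ltn_ord n; rewrite /G; lia.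
  apply: le_trans (nonflat_level nG); rewrite mulr_sumr; apply: ler_sum => a _.
  rewrite le_eqVlt; apply/orP; left; apply/eqP; rewrite /c0.
  have -> : (2 ^ (G * k))%:R = (2 ^ ((G - (n + rho)) * k))%:R * (2 ^ (n * k))%:R *
      (2 ^ (rho * k))%:R :> R.
    by rewrite -!natrM -!expnD -!mulnDl; congr (2 ^ (_ * _))%:R; lia.
  by field; rewrite !pnatr_eq0 !expn_eq0.
apply: (le_trans (ler_wpM2l _ total_le)) => //.
rewrite le_eqVlt; apply/orP; left; apply/eqP; rewrite /c0 mulSn expnD natrM.
by field; rewrite gt_eqF //= pnatr_eq0 expn_eq0.
Qed.

End Packing.

(** * Collapsed cubes *)

(* In the application [b = 2 ^ i] is about [1 / alpha]. The steps
   [h = 2 ^- (n + 2 * i) *: v], [|v| <= 2 b], are [1 / b] times the vectors joining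
   points at distance about [2 ^- n]. A line has [2 ^ (2 * i + 3) = 8 b ^ 2] steps,
   long enough that a parallel line at distance [O(2 ^- n)] has the same rate up
   to [O(alpha 2 ^- n / b)]; the threshold makes the errors of its [2 * i + 3]
   doublings add up to at most [2 ^- (n + 2 * i) / 2]. *)
Definition flatness {R : realType} {k} (i : nat) (d : 'rV[R]_k -> 'rV[R]_k -> R) :=
  flat d (2 * i) (2 * 2 ^ i) (2 * i + 3) ((4 * (2 * i + 3)%:R) ^- 2).

Section Collapse.
Context {R : realType} {k : nat}.
Variable d : 'rV[R]_k.+1 -> 'rV[R]_k.+1 -> R.
Hypothesis d_refl : forall x, d x x = 0.
Hypothesis d_sym : forall x y, d x y = d y x.
Hypothesis d_triangle : forall x y z, d x z <= d x y + d y z.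
Hypothesis d_lip : forall x y, d x y <= `|x - y|.
Variables (alpha : R) (i n : nat).
Hypothesis alpha_large : 1 <= alpha * 2 ^+ i.
Hypothesis i_gt0 : (0 < i)%N.
Let b : R := 2 ^+ i.
Let l : R := 2 ^- n.
Let b_gt0 : 0 < b. Proof. exact: expr2_gt0. Qed.
Let l_gt0 : 0 < l. Proof. by rewrite invr_gt0 expr2_gt0. Qed.
Let lb : l / b <= alpha * l.
Proof. by rewrite ler_pdivrMr // mulrAC ler_peMl // ltW. Qed.
Let lb2 : l / b <= l / 2.
Proof.
rewrite ler_pM2l // lef_pV2 ?posrE // /b -(prednK i_gt0) exprS ler_peMr //.
by rewrite exprn_ege1 ?ler1n.
Qed.
Variables (x y : 'rV[R]_k.+1).
Hypothesis x_flat : flatness i d n x.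
Hypothesis xy_itv : l <= `|x - y| <= 2 * l.
Hypothesis d_small : d x y <= alpha * `|x - y|.

(** The vector from [x] to [y] is rounded to mesh [l / b], at most [alpha * l]. The rounded vector
    [H] is [b] times an admissible step [h], to which flatness applies. *)
Let v := cube (n + i) (y - x).
Let H : 'rV[R]_k.+1 := corner (n + i) (y - x).
Let h : 'rV[R]_k.+1 := step (2 * i) n v.

Let lbE : l / b = 2 ^- (n + i). Proof. by rewrite exprD invfM. Qed.

Let h_H : b *: h = H.
Proof.
rewrite /h /step /H /corner scalerA; congr (_ *: _).
by rewrite /b mul2n -addnn !exprD; field; rewrite !expr2_neq0.
Qed.

Let H_close : `|y - x - H| <= l / b.
Proof. by rewrite lbE; exact: corner_dist. Qed.

Let v_le : `|map_mx intr v : 'rV[R]_k.+1| <= (2 * 2 ^ i)%:R.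
Proof.
apply: norm_le => // j; rewrite mxE -intr_norm -[(2 * _)%:R]/(Posz (2 * 2 ^ i)%N)%:~R ler_int.
have /andP[_ xy2] := xy_itv.
have yxj : `|(y - x) ord0 j| <= 2 * l.
  by rewrite (le_trans (norm_coord _ _)) // distrC.
have : `|2 ^+ (n + i) * (y - x) ord0 j| <= (Posz (2 * 2 ^ i)%N)%:~R.
  rewrite normrM (ger0_norm (ltW (expr2_gt0 _))) -[_%:~R]/((2 * 2 ^ i)%:R) natrM natrX.
  have -> : 2 * 2 ^+ i = 2 ^+ (n + i) * (2 * l) :> R.
    by rewrite exprD /l; field; rewrite expr2_neq0.
  by rewrite ler_pM2l ?expr2_gt0.
rewrite ler_norml => /andP[h1 h2].
have /andP[] := cube_itv (n + i) (y - x) j; rewrite -/v => h3 h4.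
have := le_lt_trans h1 h4; have := le_trans h3 h2.
rewrite -mulrNz ler_int ltr_int.
by move: (v ord0 j) (2 * 2 ^ i)%N => q m; clear; lia.
Qed.

Let h_le : `|h| <= 2 * (l / b).
Proof.
rewrite -(ler_pM2l b_gt0) -{1}(ger0_norm (ltW b_gt0)) -normrZ h_H /H /corner.
rewrite normrZ normfV (ger0_norm (ltW (expr2_gt0 _))) -lbE.
have -> : b * (2 * (l / b)) = l / b * (2 * b) by ring.
rewrite ler_pM2l ?divr_gt0 //; apply: (le_trans v_le).
by rewrite natrM natrX.
Qed.

Let e : R := 2 ^- (n + 2 * i) / (4 * (2 * i + 3)%:R).

Let flat_deficit z j : `|z - corner n x| <= 10 * l -> (j < 2 * i + 3)%N ->
  deficit d h j z <= e ^+ 2.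
Proof.
move=> zx jJ; have := x_flat zx v_le jJ.
rewrite -ler_pdivlMr ?exprn_gt0 ?expr2_gt0 // => /le_trans; apply.
by rewrite /e [leRHS]exprMn !exprVn mulrC.
Qed.

Let e_ge0 : 0 <= e. Proof. by rewrite divr_ge0 ?mulr_ge0 ?invr_ge0 ?ltW ?expr2_gt0. Qed.

Let Je : (2 * i + 3)%:R * (2 * e) = l / b / b / 2.
Proof.
rewrite /e; have J0 : (2 * i + 3)%:R != 0 :> R by rewrite pnatr_eq0 addn_eq0 andbF.
move: (_%:R : R) J0 => Jr J0; rewrite /b /l mul2n -addnn !exprD.
by field; rewrite J0 !expr2_neq0.
Qed.

(** Three comparisons. On the line through [x], the rate at scale [i], small because [d x y] is
    small, agrees with the rate at scale [2 * i + 3]; at that scale the parallel lines through [x]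
    and [z] have close rates; on the line through [z] the long rate agrees with that of a single
    step. *)
Lemma rate_step_le z : `|z - corner n x| <= 10 * l -> d z (z + h) <= 7 * alpha * (l / b).
Proof.
move=> zx.
have xx : `|x - corner n x| <= 10 * l.
  by apply: (le_trans (corner_dist _ _)); rewrite -/l; have := l_gt0; lra.
have x0 : `|rate d h (2 * i + 3) x - rate d h i x| <= l / b / b / 2.
  rewrite -Je; apply: rate_close => // [|j jJ]; [|exact: flat_deficit xx jJ].
  by rewrite mul2n -addnn -addnA leq_addr.
have z0 : `|rate d h (2 * i + 3) z - rate d h 0 z| <= l / b / b / 2.
  by rewrite -Je; apply: rate_close => // j jJ; exact: flat_deficit zx jJ.
have xz := rate_lip d_sym d_triangle d_lip h (2 * i + 3) z x.
have zx11 : `|z - x| <= 11 * l.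
  rewrite -(subrKA (corner n x)); apply: (le_trans (ler_normD _ _)).
  by have := corner_dist n x; rewrite distrC -/l; lra.
have lbb : l / b / b <= alpha * (l / b).
  by rewrite mulrA ler_pM2r ?invr_gt0.
have {}xz : `|rate d h (2 * i + 3) z - rate d h (2 * i + 3) x| <= 11 / 4 * (l / b / b).
  apply: (le_trans xz); have -> : 2 ^+ (2 * i + 3) = 8 * b * b :> R.
    by rewrite mul2n -addnn !exprD /b; ring.
  rewrite ler_pdivrMr ?mulr_gt0 //.
  have -> : 11 / 4 * (l / b / b) * (8 * b * b) = 22 * l :> R by field; rewrite gt_eqF.
  lra.
have xi : rate d h i x <= 3 * (alpha * (l / b)).
  rewrite /rate -/b h_H ler_pdivrMr //.
  have -> : 3 * (alpha * (l / b)) * b = 3 * alpha * l by field; rewrite gt_eqF.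
  have := d_triangle x y (x + H); have := d_lip y (x + H).
  rewrite opprD addrA; have := H_close; have := lb; have := d_small.
  have /andP[_] := xy_itv; have a0 : 0 < alpha.
    by have := lt_le_trans ltr01 alpha_large; rewrite pmulr_lgt0.
  by rewrite -(ler_pM2l a0); lra.
have -> : d z (z + h) = rate d h 0 z by rewrite /rate expr0 divr1 scale1r.
move: x0 z0 xz; rewrite !ler_norml => /andP[? ?] /andP[? ?] /andP[? ?]; lra.
Qed.

Lemma steps_le z s : (forall s', (s' < s)%N -> `|z + s'%:R *: h - corner n x| <= 10 * l) ->
  d z (z + s%:R *: h) <= s%:R * (7 * alpha * (l / b)).
Proof.
elim: s => [|s IH] hs; first by rewrite scale0r addr0 d_refl mul0r.
apply: (le_trans (d_triangle _ (z + s%:R *: h) _)).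
rewrite -natr1 mulrDl mul1r scalerDl scale1r addrA; apply: lerD.
  by apply: IH => s' s's; apply: hs; rewrite ltnW.
exact/rate_step_le/hs.
Qed.

Let alpha_gt0 : 0 < alpha.
Proof. by have := lt_le_trans ltr01 alpha_large; rewrite pmulr_lgt0. Qed.

Lemma segment_le z t : 0 <= t <= 2 -> t * `|H| <= l ->
  `|z - corner n x| <= 2 * l -> d z (z + t *: H) <= 16 * alpha * l.
Proof.
(* As [t *: H] is [t * b] times [h], at most [2 * b] whole steps cost [14 * alpha * l], and the
   remaining fraction of a step costs at most [2 * alpha * l]. *)
move=> /andP[t0 t2] tH zx; pose s := Num.truncn (t * b).
have tb0 : 0 <= t * b by rewrite mulr_ge0 // ltW.
have /andP[s1 s2] : s%:R <= t * b < s.+1%:R by exact: truncn_itv.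
have bh : b * `|h| = `|H| by rewrite -h_H [RHS]normrZ gtr0_norm.
have ds : d z (z + s%:R *: h) <= s%:R * (7 * alpha * (l / b)).
  apply: steps_le => s' ss'.
  have s'tb : s'%:R <= t * b by apply: le_trans s1; rewrite ler_nat ltnW.
  rewrite addrAC; apply: (le_trans (ler_normD _ _)).
  rewrite normrZ normr_nat.
  have : s'%:R * `|h| <= t * b * `|h| by rewrite ler_wpM2r.
  rewrite -mulrA bh; have := l_gt0; lra.
have e1 : s%:R * (7 * alpha * (l / b)) <= 14 * alpha * l.
  have : s%:R * (7 * alpha * (l / b)) <= t * b * (7 * alpha * (l / b)).
    by rewrite ler_wpM2r // !mulr_ge0 ?invr_ge0 // ltW.
  have -> : t * b * (7 * alpha * (l / b)) = t * (7 * alpha * l).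
    by field; rewrite gt_eqF.
  have : t * (7 * alpha * l) <= 2 * (7 * alpha * l).
    by rewrite ler_wpM2r // !mulr_ge0 // ltW.
  lra.
have e2 : d (z + s%:R *: h) (z + t *: H) <= 2 * (alpha * l).
  apply: (le_trans (d_lip _ _)).
  have -> : z + s%:R *: h - (z + t *: H) = (s%:R - t * b) *: h.
    by rewrite -h_H [t *: _]scalerA [RHS]scalerBl opprD addrACA subrr add0r.
  rewrite [leLHS]normrZ.
  have : `|s%:R - t * b| <= 1.
    by move: s2; rewrite -natr1 => s2; rewrite ler_norml; apply/andP; split; lra.
  move=> /(ler_wpM2r (normr_ge0 h)); rewrite mul1r.
  by have := h_le; have := lb; lra.
by have := d_triangle z (z + s%:R *: h) (z + t *: H); lra.
Qed.

Let H_ge : l / 2 <= `|H|.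
Proof.
have /andP[xy1 _] := xy_itv; have := H_close; have := lb2.
have := lerB_dist (y - x) H; rewrite (distrC x y) in xy1.
rewrite (_ : `|y - x| - `|H| <= _ = (`|y - x| - `|H| <= `|y - x - H|)) //.
lra.
Qed.

(* The tubes: project the cube along [H] to a face transversal to [H], and cut
   the projection into cells of side [l / b]. *)
Lemma collapse_cover : exists A : {ffun 'I_k -> 'I_(4 * 2 ^ i)} -> set 'rV[R]_k.+1,
  (forall z, cube n z = cube n x -> exists w, A w z) /\
  (forall w z z', A w z -> A w z' -> d z z' <= 33 * alpha * l).
Proof.
(* With the largest coordinate of [H], projecting along [H] to the face through the corner moves a
   point of the cube by at most [l]. *)
have [j Hj] := norm_max_coord H.
have Hj0 : H ord0 j != 0.
  by rewrite -normr_gt0 -Hj (lt_le_trans _ H_ge) // divr_gt0.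
pose c := corner n x.
pose t (z : 'rV[R]_k.+1) := (z ord0 j - c ord0 j) / H ord0 j.
pose p (z : 'rV[R]_k.+1) := z - t z *: H.
(* Adding [l] puts the transversal coordinate into [[0, 3 * l]], so the cell indices stay below
   [4 * b]. *)
pose g (z : 'rV[R]_k.+1) m :=
  Num.truncn ((p z ord0 (lift j m) - c ord0 (lift j m) + l) * (b / l)).
have zc z (m : 'I_k.+1) : cube n z = cube n x -> 0 <= z ord0 m - c ord0 m <= l.
  move=> zx; have /andP[z1 z2] := cube_itv n z m.
  rewrite /c /corner -zx !mxE; rewrite !mxE in z1 z2.
  move: z1 z2; set q := Num.floor _; rewrite intrD => z1 z2.
  have -> : z ord0 m - 2 ^- n * q%:~R = (2 ^+ n * z ord0 m - q%:~R) * l.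
    by rewrite /l mulrBl mulrAC mulfV ?expr2_neq0 // mul1r [_ * q%:~R]mulrC.
  rewrite mulr_ge0 ?ler_piMl ?(ltW l_gt0) //; lra.
have tl z : cube n z = cube n x -> `|t z| * `|H| <= l /\ `|t z| <= 2.
  move=> zx; have /andP[z1 z2] := zc z j zx.
  have e1 : `|t z| * `|H| = z ord0 j - c ord0 j.
    by rewrite Hj -normrM /t divfK // ger0_norm.
  split; first by rewrite e1.
  rewrite -(ler_pM2r (x := `|H|)) ?(lt_le_trans _ H_ge) ?divr_gt0 // e1.
  by have := H_ge; lra.
have pc z : cube n z = cube n x -> `|p z - c| <= 2 * l.
  move=> zx; have [tH _] := tl z zx; rewrite /p addrAC.
  apply: (le_trans (ler_normB _ _)); rewrite normrZ.
  have : `|z - c| <= l.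
    apply: norm_le => [|m]; first exact: ltW.
    have -> : (z - c) ord0 m = z ord0 m - c ord0 m by rewrite !mxE.
    by have /andP[z1 z2] := zc z m zx; rewrite ger0_norm.
  lra.
have zp z : cube n z = cube n x -> d z (p z) <= 16 * alpha * l.
  move=> zx; have [tH t2] := tl z zx; have [t0|t0] := leP 0 (t z).
    rewrite d_sym -{2}(subrK (t z *: H) z) -/(p z).
    apply: segment_le; last exact: pc.
      by rewrite ger0_norm // in t2; rewrite t0.
    by rewrite ger0_norm // in tH.
  rewrite /p -scaleNr; apply: segment_le.
  - by rewrite ltr0_norm // in t2; rewrite oppr_ge0 ltW.
  - by rewrite ltr0_norm // in tH.
  - have := corner_dist n z; rewrite /corner zx -/(corner n x) -/l.
    by have := l_gt0; lra.
pose A (w : {ffun 'I_k -> 'I_(4 * 2 ^ i)}) : set 'rV[R]_k.+1 :=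
  [set z | cube n z = cube n x /\ forall m, g z m = w m].
have bl0 : 0 < b / l by rewrite divr_gt0.
have bl : l * (b / l) = b by rewrite mulrCA divff ?mulr1 // gt_eqF.
have pg z m : cube n z = cube n x ->
    (g z m)%:R <= (p z ord0 (lift j m) - c ord0 (lift j m) + l) * (b / l) < (g z m).+1%:R
    /\ (p z ord0 (lift j m) - c ord0 (lift j m) + l) * (b / l) <= 3 * b.
  move=> zx; have /andP[z1 z2] := zc z (lift j m) zx; have [tH _] := tl z zx.
  have : `|(t z *: H) ord0 (lift j m)| <= l.
    by apply: le_trans (norm_coord _ _) _; rewrite normrZ.
  rewrite ler_norml => /andP[h1 h2].
  have pE : p z ord0 (lift j m) = z ord0 (lift j m) - (t z *: H) ord0 (lift j m).
    by rewrite !mxE.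
  split.
    apply: truncn_itv; rewrite mulr_ge0 ?(ltW bl0) // pE; lra.
  have -> : 3 * b = 3 * l * (b / l) by rewrite -mulrA bl.
  rewrite ler_pM2r // pE; lra.
have lt_g z m : cube n z = cube n x -> (g z m < 4 * 2 ^ i)%N.
  move=> zx; have [/andP[g1 _] g2] := pg z m zx.
  rewrite -(ltr_nat R) natrM natrX -/b; have := b_gt0; lra.
exists A; split=> [z zx|w z z' [zx zw] [zx' zw']].
  by exists [ffun m => Ordinal (lt_g z m zx)]; split=> // m; rewrite ffunE.
have pp : `|p z - p z'| <= l / b.
  apply: norm_le => [|m]; first by rewrite divr_ge0 ?ltW.
  have -> : (p z - p z') ord0 m = p z ord0 m - p z' ord0 m by rewrite !mxE.
  have [m' ->|->] := unliftP j m.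
    have [/andP[h1 h2] _] := pg z m' zx; have [/andP[h3 h4] _] := pg z' m' zx'.
    rewrite zw -zw' in h1 h2.
    have -> : l / b = (b / l)^-1 by rewrite invf_div.
    rewrite -[leRHS]mul1r ler_pdivlMr //.
    rewrite -{1}(ger0_norm (ltW bl0)) -normrM.
    have -> : (p z ord0 (lift j m') - p z' ord0 (lift j m')) * (b / l) =
      (p z ord0 (lift j m') - c ord0 (lift j m') + l) * (b / l) -
      (p z' ord0 (lift j m') - c ord0 (lift j m') + l) * (b / l) by ring.
    rewrite -natr1 in h2 h4.
    by rewrite ler_norml; apply/andP; split; lra.
  have pj u : p u ord0 j = c ord0 j.
    have -> : p u ord0 j = u ord0 j - t u * H ord0 j by rewrite !mxE.
    by rewrite /t divfK // subKr.
  by rewrite !pj subrr normr0 divr_ge0 ?ltW.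
(* The constant is [33 = 16 + 1 + 16]: to the projection, across a cell, and back. *)
have := zp z zx; have := zp z' zx'; rewrite (d_sym z').
have := d_triangle z (p z) z'; have := d_triangle (p z) (p z') z'.
by have := d_lip (p z) (p z'); have := lb; lra.
Qed.

End Collapse.

(** * Coding *)

Section Coding.
Context {R : realType} {k : nat}.

(** Residues modulo 3 separate distinct cubes whose indices differ by at most 2 in each coordinate.
    The second alphabet has one symbol more than there are neighbours, so one is always free. *)
Definition letter : finType := (box k 3 * 'I_(5 ^ k).+1)%type.

Let letter0 : letter := ([ffun=> ord0], ord0).

Definition residue n (x : 'rV[R]_k) : box k 3 :=
  [ffun j => inord `|(cube n x ord0 j %% 3)%Z|].

Definition fresh (s : seq 'I_(5 ^ k).+1) : 'I_(5 ^ k).+1 :=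
  odflt ord0 [pick c | c \notin s].

Lemma fresh_notin s : (size s <= 5 ^ k)%N -> fresh s \notin s.
Proof.
rewrite /fresh; case: pickP => //= s_all s_le.
have : (#|'I_(5 ^ k).+1| <= size s)%N.
  rewrite (leq_trans _ (card_size s)) // subset_leq_card //.
  by apply/fintype.subsetP => c _; have /negbFE := s_all c.
by rewrite card_ord ltnNge s_le.
Qed.

Variable bad : nat -> 'rV[R]_k -> bool.
Hypothesis bad_cube : forall n x y, cube n x = cube n y -> bad n x = bad n y.
Implicit Types (x y : 'rV[R]_k) (n m : nat).

Definition neighbour n x (o : box k (2 * 2).+1) : 'rV[R]_k :=
  2 ^- n *: map_mx intr (cube n x + ivec o).

(* One letter per bad level. The second component of a new letter avoids the
   letters that the words of the neighbouring cubes already carry at the same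
   position, so that two neighbouring bad cubes receive incomparable words even
   when they have different numbers of bad ancestors. *)
Fixpoint word n x : seq letter :=
  if n isn't n'.+1 then [::] else
  let w := word n' x in
  if bad n' x then
    rcons w (residue n' x, fresh [seq (nth letter0 (word n' (neighbour n' x o)) (size w)).2
                            | o <- enum {: box k (2 * 2).+1}])
  else w.

Lemma word_cube n x y : cube n x = cube n y -> word n x = word n y.
Proof.
elim: n x y => [//|n IH] x y exy.
have e : cube n x = cube n y by exact: cube_anti exy.
rewrite /= (bad_cube e) (IH _ _ e) /residue e.
by under eq_map do rewrite /neighbour e.
Qed.

Lemma size_word n x : size (word n x) = (\sum_(m < n) bad m x)%N.
Proof.
elim: n => [|n IH]; first by rewrite big_ord0.
rewrite big_ord_recr /= -IH; case: (bad n x); last by rewrite addn0.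
by rewrite size_rcons addn1.
Qed.

(** Words only grow with the level, so a letter once written is final. *)
Lemma nth_word n m x i : (m <= n)%N -> (i < size (word m x))%N ->
  (i < size (word n x))%N /\ nth letter0 (word n x) i = nth letter0 (word m x) i.
Proof.
move=> /subnK <-; elim: (n - m)%N => [//|e IH] im.
have [ie <-] := IH im; rewrite addSn /=; case: ifP => // _.
by rewrite nth_rcons ie size_rcons leqW.
Qed.

(** The two words differ where [x] receives its new letter: [y] already has a letter there, and the
    fresh symbol avoids it. *)
Lemma word_lt n x y : bad n x -> (size (word n x) < size (word n y))%N ->
  (forall j, `|cube n y ord0 j - cube n x ord0 j| <= 2) ->
  exists i, [/\ (i < size (word n.+1 x))%N, (i < size (word n.+1 y))%N &
    nth letter0 (word n.+1 x) i != nth letter0 (word n.+1 y) i].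
Proof.
move=> bx sxy near; exists (size (word n x)).
have [hy ->] := nth_word (leqnSn n) sxy; split => //.
  by rewrite /= bx size_rcons.
rewrite /= bx nth_rcons ltnn eqxx; apply/eqP => /(congr1 snd) /= e.
have [w ow] : exists o, cube n y - cube n x = @ivec k 2 o.
  by apply: ivec_surj => j; rewrite !mxE; have := near j; rewrite !mxE.
have sz : (size (enum {: box k (2 * 2).+1}) <= 5 ^ k)%N by rewrite -cardE card_box.
set s := [seq _ | o <- _] in e; have := @fresh_notin s.
rewrite size_map => /(_ sz); rewrite e => /negP; apply; apply/mapP.
exists w; rewrite ?mem_enum //; congr (nth _ _ _).2.
apply: word_cube; rewrite /neighbour -ow [_ + _]addrC subrK.
by rewrite cube_lattice.
Qed.

Lemma word_neq n x y : bad n x -> bad n y -> cube n x != cube n y ->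
  (forall j, `|cube n y ord0 j - cube n x ord0 j| <= 2) ->
  exists i, [/\ (i < size (word n.+1 x))%N, (i < size (word n.+1 y))%N &
    nth letter0 (word n.+1 x) i != nth letter0 (word n.+1 y) i].
Proof.
move=> bx by_ xy near; case: (ltngtP (size (word n x)) (size (word n y))) => [h|h|h].
- exact: word_lt.
- have [|i [iy ix e]] := word_lt by_ h; first by move=> j; rewrite distrC.
  by exists i; split=> //; rewrite eq_sym.
(* For words of equal length the new letters share a position, and equal residues would force equal
   indices. *)
exists (size (word n x)); rewrite /= bx by_ !size_rcons h; split=> //.
rewrite !nth_rcons h ltnn eqxx; apply/negP => /eqP /(congr1 fst) /= /ffunP e.
move/negP: xy; apply; apply/eqP/rowP => j.
have := congr1 val (e j); have := near j; rewrite !ffunE /=.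
move: (cube n x ord0 j) (cube n y ord0 j) => p q pq.
rewrite !inordK; by lia.
Qed.

(** The limit of the words of [x], cut to [N] letters and padded by [None]; by [nth_word] the chosen
    level is immaterial. *)
Definition color N x : {ffun 'I_N -> option letter} :=
  [ffun i : 'I_N => match pselect (exists n, (i < size (word n x))%N) with
    | left h => Some (nth letter0 (word (projT1 (cid h)) x) i)
    | right _ => None
    end].

Lemma colorE N x (i : 'I_N) n : (i < size (word n x))%N ->
  color N x i = Some (nth letter0 (word n x) i).
Proof.
move=> ix; rewrite ffunE; case: pselect => [h|]; last by case; exists n.
case: cid => m /= im; congr Some.
have [mn|nm] := leqP m n; first by have [_ ->] := nth_word mn im.
by have [_ ->] := nth_word (ltnW nm) ix.
Qed.

End Coding.

Lemma far_cubes (R : realType) k n (x y : 'rV[R]_k.+1) :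
  2 ^- n <= `|x - y| -> cube n x != cube n y.
Proof.
move=> xy; apply/eqP => e; have [j ej] := norm_max_coord (x - y).
move: xy; rewrite ej leNgt => /negP; apply.
have /andP[x1 x2] := cube_itv n x j; have /andP[y1 y2] := cube_itv n y j.
rewrite -e in y1 y2; rewrite intrD in x2 y2.
have -> : (x - y) ord0 j = x ord0 j - y ord0 j by rewrite !mxE.
rewrite -[ltRHS]mul1r ltr_pdivlMr ?expr2_gt0 //.
rewrite -[X in _ * X](ger0_norm (ltW (expr2_gt0 n))) -normrM mulrBl.
by rewrite ltr_norml ![_ * 2 ^+ n]mulrC; apply/andP; split; lra.
Qed.

Lemma near_cubes (R : realType) k n (x y : 'rV[R]_k) :
  `|x - y| < 2 / 2 ^+ n -> forall j, `|cube n y ord0 j - cube n x ord0 j| <= 2.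
Proof.
move=> xy j; have := le_lt_trans (norm_coord _ j) xy.
have /andP[x1 x2] := cube_itv n x j; have /andP[y1 y2] := cube_itv n y j.
have -> : (x - y) ord0 j = x ord0 j - y ord0 j by rewrite !mxE.
rewrite ltr_pdivlMr ?expr2_gt0 //.
rewrite -[X in _ * X](ger0_norm (ltW (expr2_gt0 n))) -normrM mulrBl.
rewrite ltr_norml ![_ * 2 ^+ n]mulrC => /andP[h1 h2].
rewrite !intrD in x2 y2.
have : (cube n y ord0 j)%:~R < (cube n x ord0 j + 3)%:~R :> R by rewrite intrD; lra.
have : (cube n x ord0 j)%:~R < (cube n y ord0 j + 3)%:~R :> R by rewrite intrD; lra.
rewrite !ltr_int; move: (cube n x ord0 j) (cube n y ord0 j) => p q; clear; lia.
Qed.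

Lemma coding (R : realType) k N (bad : nat -> 'rV[R]_k.+1 -> bool) :
  (forall n x y, cube n x = cube n y -> bad n x = bad n y) ->
  exists col : 'rV[R]_k.+1 -> {ffun 'I_N -> option (@letter k.+1)},
  forall x y n, (forall m, \sum_(j < m) bad j x <= N)%N -> bad n x -> bad n y ->
    2 ^- n <= `|x - y| < 2 / 2 ^+ n -> col x != col y.
Proof.
move=> bad_cube; exists (color bad N) => x y n xN bx by_ /andP[xy1 xy2].
have [i [ix iy xyi]] := word_neq bad_cube bx by_ (far_cubes xy1) (near_cubes xy2).
have iN : (i < N)%N by apply: leq_trans (xN n.+1); rewrite -size_word.
apply/eqP => /ffunP /(_ (Ordinal iN)); rewrite (@colorE _ _ _ _ _ _ n.+1) //.
rewrite (@colorE _ _ _ _ _ _ n.+1) // => -[] /eqP; rewrite (negbTE xyi) //.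
Qed.

(** * Stopping cubes *)

Section Stopping.
Context {R : realType} {k : nat}.
Implicit Types (P : nat -> 'rV[R]_k -> bool) (x y : 'rV[R]_k) (n m N : nat).

Definition cubewise P := forall n x y, cube n x = cube n y -> P n x = P n y.

(** The cube where [P] holds for the [N0 + 1]-st time on the way down to [x]; for [N0 = 0] these are
    the maximal cubes of [P]. *)
Definition stop P N0 n x := P n x && (\sum_(m < n) P m x == N0)%N.

Lemma stop_cubewise P N0 : cubewise P -> cubewise (stop P N0).
Proof.
move=> Pc n x y exy; rewrite /stop (Pc _ _ _ exy); congr (_ && (_ == _)).
by apply: eq_bigr => m _; rewrite (Pc _ _ y) //; apply: cube_anti exy; rewrite ltnW.
Qed.

Lemma sum_stop P N0 N x :
  (\sum_(n < N) stop P N0 n x = (N0 < \sum_(n < N) P n x))%N.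
Proof.
elim: N => [|N IH]; first by rewrite !big_ord0.
rewrite !big_ord_recr /= IH /stop; move: (\sum_(n < N) P n x)%N => s.
by case: (P N x); case: ltngtP => /=; lia.
Qed.

Lemma sum_stop_le1 P N0 N x : (\sum_(n < N) stop P N0 n x <= 1)%N.
Proof. by rewrite sum_stop leq_b1. Qed.

Lemma sum_stop_markov P N0 N x :
  (N0.+1 * \sum_(n < N) stop P N0 n x <= \sum_(n < N) P n x)%N.
Proof. by rewrite sum_stop; case: ltnP => h; rewrite ?muln1 ?muln0. Qed.

Lemma no_stop P N0 x : (forall n, ~~ stop P N0 n x) ->
  forall m, (\sum_(j < m) P j x <= N0)%N.
Proof.
move=> h m; have := sum_stop P N0 m x; rewrite big1; last first.
  by move=> j _; rewrite (negbTE (h j)).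
by case: ltnP.
Qed.

(** Total volume of the level [n] cubes of [P] in the period $[0,2)^k$, itself of volume $2^k$. *)
Definition volume P n : R :=
  \sum_(a : box k (2 ^ n.+1)) (P n (grid n a))%:R / (2 ^ (n * k))%:R.

Lemma volume_grid P n G : cubewise P -> (n <= G)%N ->
  volume P n = \sum_(y : box k (2 ^ G.+1)) (P n (grid G y))%:R / (2 ^ (G * k))%:R.
Proof.
move=> Pc nG; rewrite /volume -!mulr_suml.
rewrite (@sum_grid_cubes _ _ n G (fun x => (P n x)%:R) nG); last first.
  by move=> x y exy; rewrite (Pc _ _ _ exy).
have -> : (2 ^ (G * k))%:R = (2 ^ ((G - n) * k))%:R * (2 ^ (n * k))%:R :> R.
  by rewrite -natrM -expnD -mulnDl subnK.
by rewrite -mulf_div mulfV ?mul1r // pnatr_eq0 expn_eq0.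
Qed.

Lemma sum_volume P N : cubewise P -> \sum_(n < N) volume P n =
  \sum_(y : box k (2 ^ N.+1)) (\sum_(n < N) P n (grid N y))%N%:R / (2 ^ (N * k))%:R.
Proof.
move=> Pc; rewrite (eq_bigr (fun n : 'I_N => \sum_(y : box k (2 ^ N.+1))
  (P n (grid N y))%:R / (2 ^ (N * k))%:R)).
  rewrite exchange_big; apply: eq_bigr => y _ /=.
  by rewrite -mulr_suml natr_sum.
by move=> n _; apply: volume_grid => //; rewrite ltnW.
Qed.

(** Chebyshev's inequality: a point in a stopping cube lies in [N0 + 1] cubes of [P]. *)
Lemma volume_stop_markov P N0 N : cubewise P ->
  N0.+1%:R * \sum_(n < N) volume (stop P N0) n <= \sum_(n < N) volume P n.
Proof.
move=> Pc; rewrite !sum_volume //; last exact: stop_cubewise.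
rewrite mulr_sumr; apply: ler_sum => y _.
rewrite mulrA ler_wpM2r ?invr_ge0 // -natrM ler_nat.
exact: sum_stop_markov.
Qed.

(** A point lies in at most one stopping cube, so their volumes add up to at most that of the
    period. *)
Lemma volume_stop_le P N0 N : cubewise P ->
  \sum_(n < N) volume (stop P N0) n <= (2 ^ k)%:R.
Proof.
move=> Pc; rewrite sum_volume //; last exact: stop_cubewise.
apply: (@le_trans _ _ (\sum_(y : box k (2 ^ N.+1)) (2 ^ (N * k))%:R^-1)).
  apply: ler_sum => y _; rewrite ler_piMl ?invr_ge0 //.
  by rewrite -[leRHS]/(1%:R) ler_nat sum_stop_le1.
rewrite sumr_const card_box -[leLHS]mulr_natr -expnM mulSn expnD.
by rewrite [(2 ^ k * _)%:R]natrM mulrC mulfK // pnatr_eq0 expn_eq0.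
Qed.

Lemma volume_le P (Q : nat -> _ -> bool) n :
  (forall x, P n x -> Q n x) -> volume P n <= volume Q n.
Proof.
move=> PQ; apply: ler_sum => a _; rewrite ler_wpM2r ?invr_ge0 // ler_nat.
by case: (P n _) (PQ (grid n a)) => // ->.
Qed.

(** A coordinate equal to [1] has index [2 ^ n], which the box of the doubled period still
    contains. *)
Lemma unit_cube_box n x : unit_cube x ->
  exists a : box k (2 ^ n.+1), cube n x = cube n (grid n a : 'rV[R]_k).
Proof.
move=> x01.
have h j : 0 <= cube n x ord0 j <= Posz (2 ^ n).
  have /andP[x0 x1] := x01 j; rewrite mxE floor_ge_int; apply/andP; split.
    by rewrite mulr_ge0 // ltW ?expr2_gt0.
  rewrite -ltzD1 floor_lt_int intrD.
  apply: (@le_lt_trans _ _ (2 ^+ n)); first by rewrite ler_piMr // ltW ?expr2_gt0.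
  by rewrite -natrX ltrDl.
have lt j : (`|cube n x ord0 j| < 2 ^ n.+1)%N.
  rewrite expnS; have := h j; have : (0 < 2 ^ n)%N by rewrite expn_gt0.
  move: (2 ^ n)%N (cube n x ord0 j) => p q; clear; lia.
exists [ffun j => Ordinal (lt j)]; rewrite cube_grid; apply/rowP => j.
rewrite [RHS]mxE ffunE /=; have := h j; move: (cube n x) => q.
by move=> /andP[q0 _]; rewrite gez0_abs.
Qed.

Lemma cube_diam n x y : cube n x = cube n y -> `|x - y| <= 2 / 2 ^+ n.
Proof.
move=> e; rewrite -(subrKA (corner n x)); apply: (le_trans (ler_normD _ _)).
have := corner_dist n x; have := corner_dist n y.
by rewrite /corner -e [ `|_ - y| ]distrC; lra.
Qed.

End Stopping.

(** * Decomposition of a periodic pseudometric *)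

Lemma dyadic_scale (R : realType) (alpha : R) : 0 < alpha -> alpha < 1 ->
  exists i, [/\ (0 < i)%N, 1 <= alpha * 2 ^+ i & alpha * 2 ^+ i <= 2].
Proof.
move=> a0 a1.
have ex : exists i, 1 <= alpha * 2 ^+ i.
  have ai : 0 <= alpha^-1 by rewrite invr_ge0 ltW.
  exists (Num.bound alpha^-1); rewrite -ler_pdivrMl // mulr1.
  apply: ltW (lt_trans (archi_boundP ai) _).
  by rewrite -natrX ltr_nat ltn_expl.
case: (ex_minnP ex) => -[|i] hi imin.
  by move: hi; rewrite expr0 mulr1 leNgt a1.
exists i.+1; split => //.
have : ~~ (1 <= alpha * 2 ^+ i).
  by apply/negP => /imin; rewrite ltnn.
by rewrite -ltNge exprS => h; rewrite mulrCA; lra.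
Qed.

Section Core.
Context {R : realType} {k : nat}.
Variables (alpha : R) (i N0 : nat).
Hypotheses (alpha_gt0 : 0 < alpha) (alpha_lt1 : alpha < 1).
Hypothesis i_gt0 : (0 < i)%N.
Hypothesis alpha_large : 1 <= alpha * 2 ^+ i.
Variable active : nat -> bool.
Variable d : 'rV[R]_k.+1 -> 'rV[R]_k.+1 -> R.
Hypothesis d_refl : forall x, d x x = 0.
Hypothesis d_sym : forall x y, d x y = d y x.
Hypothesis d_triangle : forall x y z, d x z <= d x y + d y z.
Hypothesis d_lip : forall x y, d x y <= `|x - y|.
Implicit Types (x y : 'rV[R]_k.+1) (n : nat).

Definition nonflat n x := `[< ~ flatness i d n x >].

Definition bad n x := active n && nonflat n x.

Definition collapsed n x := [&& active n, ~~ nonflat n x &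
  `[< exists x' y, [/\ cube n x' = cube n x, 2 ^- n <= `|x' - y| <= 2 * 2 ^- n &
        d x' y <= alpha * `|x' - y|] >]].

Lemma nonflat_cubewise : cubewise nonflat.
Proof.
move=> n x y exy; apply: asbool_equiv_eq; split=> h /flat_cube h'; apply: h; exact: h'.
Qed.

Lemma bad_cubewise : cubewise bad.
Proof. by move=> n x y exy; rewrite /bad (nonflat_cubewise exy). Qed.

Lemma collapsed_cubewise : cubewise collapsed.
Proof.
by move=> n x y exy; rewrite /collapsed (nonflat_cubewise exy) exy.
Qed.

Lemma collapsed_cover n x : collapsed n x ->
  exists A : {ffun 'I_k -> 'I_(4 * 2 ^ i)} -> set 'rV[R]_k.+1,
  (forall z, cube n z = cube n x -> exists w, A w z) /\
  (forall w z z', A w z -> A w z' -> d z z' <= 33 * alpha * 2 ^- n).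
Proof.
move=> /and3P[_ /asboolPn /contrapT x_flat /asboolP[x' [y [ex xy dxy]]]].
have [A [A1 A2]] := collapse_cover d_refl d_sym d_triangle d_lip alpha_large i_gt0
  (flat_cube (esym ex) x_flat) xy dxy.
by exists A; split=> // z zx; apply: A1; rewrite zx ex.
Qed.

Definition good x := (forall n, ~~ stop bad N0 n x) /\ (forall n, ~~ stop collapsed 0 n x).

(** If [d] contracted the pair at an active level, then, neither point lying in a collapsed cube,
    both would lie in non-flat cubes, and the coding would give them different colours. *)
Lemma good_bilipschitz (col : 'rV[R]_k.+1 -> {ffun 'I_N0 -> option (@letter k.+1)}) :
  (forall x y n, (forall m, \sum_(j < m) bad j x <= N0)%N -> bad n x -> bad n y ->
    2 ^- n <= `|x - y| < 2 / 2 ^+ n -> col x != col y) ->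
  forall x y n, good x -> good y -> col x = col y -> active n ->
    2 ^- n <= `|x - y| < 2 / 2 ^+ n -> alpha * `|x - y| <= d x y.
Proof.
move=> colP x y n [x1 x2] [y1 y2] cxy an xy; rewrite leNgt; apply/negP => dxy.
have ncol z : good z -> ~~ collapsed n z.
  move=> [_ z2]; apply/negP => cz; have := no_stop z2 n.+1.
  by rewrite big_ord_recr /= cz addn1.
have isbad z z' : good z -> 2 ^- n <= `|z - z'| < 2 / 2 ^+ n ->
    d z z' < alpha * `|z - z'| -> bad n z.
  move=> gz /andP[zz1 zz2] dz; have := ncol z gz; rewrite /bad /collapsed an /=.
  case: (nonflat n z) => //= /asboolPn[]; exists z, z'.
  by split=> //; rewrite ?zz1 /= ltW.
have bx : bad n x by exact: (isbad x y).
have by_ : bad n y by apply: (isbad y x); rewrite 1?distrC 1?d_sym 1?[ `|y - x|]distrC.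
by have := colP x y n (no_stop x1) bx by_ xy; rewrite cxy eqxx.
Qed.

(** [None] stands for a whole stopping cube of [bad], [Some u] for the tube [u] of a collapsed
    stopping cube. Other cubes get empty pieces of radius [0], so that the index type does not
    depend on [d]. *)
Definition piece_index n : finType :=
  (box k.+1 (2 ^ n.+1) * option {ffun 'I_k -> 'I_(4 * 2 ^ i)})%type.

Definition piece n (w : piece_index n) : set 'rV[R]_k.+1 :=
  let c := grid n w.1 in
  [set x | cube n x = cube n c /\
     if w.2 is Some u then
       exists h : collapsed n c, stop collapsed 0 n c /\ projT1 (cid (collapsed_cover h)) u x
     else stop bad N0 n c].

Definition radius n (w : piece_index n) : R :=
  let c := grid n w.1 in
  if w.2 is Some _ then (stop collapsed 0 n c)%:R * (33 * alpha * 2 ^- n)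
  else (stop bad N0 n c)%:R * (2 * 2 ^- n).

Let p2_gt0 n : 0 < 2 ^- n :> R. Proof. by rewrite invr_gt0 expr2_gt0. Qed.

Lemma radius_ge0 n (w : piece_index n) : 0 <= radius w.
Proof.
by case: w => a [u|]; rewrite /radius /= !mulr_ge0 ?(ltW (p2_gt0 _)) ?(ltW alpha_gt0).
Qed.

(** The lower bound on the radius later lets a nonempty piece absorb the error [eps]. *)
Lemma piece_active n (w : piece_index n) x : piece w x ->
  active n /\ alpha * 2 ^- n <= radius w.
Proof.
have p2 := p2_gt0 n; have ap := mulr_gt0 alpha_gt0 p2.
case: w => a [u|] /= [_].
  move=> [/andP[an _] [st _]]; split=> //; rewrite /radius /= st mul1r -mulrA.
  lra.
move=> st; split; first by case/andP: st => /andP[].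
have := alpha_lt1; rewrite -(ltr_pM2r p2); rewrite /radius /= st mul1r mul1r.
lra.
Qed.

Lemma piece_diam n (w : piece_index n) x y : piece w x -> piece w y ->
  d x y <= radius w.
Proof.
case: w => a [u|] /= [xa hx] [ya hy].
  (* The tubes are chosen from a proof of [collapsed]; proof irrelevance makes both points refer to
     the same choice. *)
  case: hx hy => [h [st Ax]] [h' [_]]; rewrite (Prop_irrelevance h' h) => Ay.
  rewrite /radius /= st mul1r.
  by move: Ax Ay; case: cid => A [_ Adiam] /=; exact: Adiam.
rewrite /radius /= hx mul1r; apply: (le_trans (d_lip _ _)).
by apply: cube_diam; rewrite xa.
Qed.

Lemma piece_cover x : unit_cube x -> ~ good x -> exists n (w : piece_index n), piece w x.
Proof.
move=> x01 ngood.
have [n [sn|sn]] : exists n, stop bad N0 n x \/ stop collapsed 0 n x.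
  apply: contra_notP ngood => /forallNP ns.
  by split=> n; apply/negP => h; apply: (ns n); [left|right].
- have [a xa] := unit_cube_box n x01; exists n, (a, None); split=> //=.
  by rewrite -(stop_cubewise N0 bad_cubewise xa).
- have [a xa] := unit_cube_box n x01.
  rewrite (stop_cubewise 0 collapsed_cubewise xa) in sn.
  have h : collapsed n (grid n a) by case/andP: sn.
  have [A1 _] := projT2 (cid (collapsed_cover h)).
  have [u Au] := A1 x xa; exists n, (a, Some u); split=> //=.
  by exists h.
Qed.

Lemma sum_radius n :
  \sum_(w : piece_index n) radius w ^+ k.+1 =
  2 ^+ k.+1 * volume (stop bad N0) n +
  (4 * 2 ^ i)%:R ^+ k * (33 * alpha) ^+ k.+1 * volume (stop collapsed 0) n.
Proof.
have e (b : bool) (c : R) : (b%:R * (c * 2 ^- n)) ^+ k.+1 =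
    c ^+ k.+1 * (b%:R / (2 ^ (n * k.+1))%:R).
  by rewrite exprMn exprMn exprVn -exprM natrX mulrCA; case: b; rewrite ?expr1n ?expr0n.
rewrite -(pair_bigA _ (fun a u => @radius n (a, u) ^+ k.+1)) /=.
rewrite (eq_bigr (fun a => 2 ^+ k.+1 * ((stop bad N0 n (grid n a))%:R / (2 ^ (n * k.+1))%:R) +
  (4 * 2 ^ i)%:R ^+ k * (33 * alpha) ^+ k.+1 *
    ((stop collapsed 0 n (grid n a))%:R / (2 ^ (n * k.+1))%:R))).
  by rewrite big_split /= -!mulr_sumr.
move=> a _; rewrite /radius /= (bigD1 None) //= e; congr (_ + _).
rewrite (eq_bigr (fun=> (33 * alpha) ^+ k.+1 *
    ((stop collapsed 0 n (grid n a))%:R / (2 ^ (n * k.+1))%:R))); last first.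
  by case=> // u _; rewrite e.
rewrite sumr_const (cardC1 None) card_option card_ffun !card_ord /=.
by rewrite -[LHS]mulr_natl mulrA -natrX.
Qed.

End Core.

Lemma nonflat_volume (R : realType) k (i : nat) :
  exists B : R, 0 <= B /\ forall d : 'rV[R]_k -> 'rV[R]_k -> R,
    (forall x, d x x = 0) -> (forall x y, d x y = d y x) ->
    (forall x y z, d x z <= d x y + d y z) -> (forall x y, d x y <= `|x - y|) ->
    (forall x y (u : 'rV[int]_k),
      d (x + 2 *: map_mx intr u) (y + 2 *: map_mx intr u) = d x y) ->
    forall N, \sum_(n < N) volume (fun n x => `[< ~ flatness i d n x >]) n <= B.
Proof.
pose J := (2 * i + 3)%N; pose tau : R := (4 * J%:R) ^- 2.
have tau0 : 0 < tau by rewrite invr_gt0 exprn_gt0 // mulr_gt0 // ltr0n /J addnS.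
pose b := (2 * 2 ^ i)%N; pose c := (2 * i)%N.
have [rho hrho] : exists rho, 16 * b%:R * 2 ^+ c <= tau * 2 ^+ rho.
  have ai : 0 <= 16 * b%:R * 2 ^+ c / tau.
    by rewrite divr_ge0 ?(ltW tau0) ?mulr_ge0 // exprn_ge0.
  exists (Num.bound (16 * b%:R * 2 ^+ c / tau)); rewrite [leRHS]mulrC -ler_pdivrMr //.
  apply: ltW (lt_trans (archi_boundP ai) _).
  move: (Num.bound _) => M; rewrite -natrX ltr_nat ltn_expl //.
exists (2 / tau * (2 ^ (rho * k))%:R * ((2 * (11 * 2 ^ rho)).+1 ^ k)%:R
     * ((2 * b).+1 ^ k)%:R * J%:R * (2 ^ k)%:R * b%:R ^+ 2); split.
  by rewrite !mulr_ge0 ?sqr_ge0 // invr_ge0 ltW.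
move=> d d0 ds dt dl dp N; exact: (nonflat_packing J tau0 d0 ds dt dl dp hrho N).
Qed.

(** The exceptional set comes with explicit pieces and radii instead of a content bound, since the
    radii must still be enlarged by [eps] when passing from [d] to [f]. *)
Theorem pseudometric_decomposition (R : realType) (k : nat) :
  exists c1 : R, 0 <= c1 /\ forall alpha : R, 0 < alpha -> alpha < 1 ->
  exists C : finType, forall (active : nat -> bool) (d : 'rV[R]_k.+1 -> 'rV[R]_k.+1 -> R),
    (forall x, d x x = 0) -> (forall x y, d x y = d y x) ->
    (forall x y z, d x z <= d x y + d y z) -> (forall x y, d x y <= `|x - y|) ->
    (forall x y (u : 'rV[int]_k.+1),
      d (x + 2 *: map_mx intr u) (y + 2 *: map_mx intr u) = d x y) ->
  exists (good : set 'rV[R]_k.+1) (col : 'rV[R]_k.+1 -> C)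
      (I : nat -> finType) (A : forall n, I n -> set 'rV[R]_k.+1) (r : forall n, I n -> R),
  [/\ forall x y n, good x -> good y -> col x = col y -> active n ->
        2 ^- n <= `|x - y| < 2 / 2 ^+ n -> alpha * `|x - y| <= d x y,
      forall x, unit_cube x -> ~ good x -> exists n w, A n w x,
      forall n w x, A n w x -> active n /\ alpha * 2 ^- n <= r n w,
      forall n w x y, A n w x -> A n w y -> d x y <= r n w &
      (forall n w, 0 <= r n w) /\
      forall N, \sum_(n < N) \sum_w r n w ^+ k.+1 <= c1 * alpha].
Proof.
exists (1 + 8 ^+ k * 66 ^+ k.+1); split; first by rewrite addr_ge0 ?mulr_ge0 ?exprn_ge0.
move=> alpha a0 a1; have [i [i0 ai1 ai2]] := dyadic_scale a0 a1.
have [B [B0 hB]] := nonflat_volume R k.+1 i.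
(* [N0] is taken so large that, by Chebyshev, the stopping cubes of [bad] contribute at most
   [alpha]. *)
pose x := 2 ^+ k.+1 * B / alpha.
have x0 : 0 <= x by rewrite divr_ge0 ?mulr_ge0 ?exprn_ge0 // ltW.
pose N0 := Num.bound x.
have N0B : 2 ^+ k.+1 * B <= N0.+1%:R * alpha.
  rewrite -ler_pdivrMr //; apply: ltW (lt_trans (archi_boundP x0) _).
  by rewrite ltr_nat.
exists {ffun 'I_N0 -> option (@letter k.+1)} => active d d0 ds dt dl dp.
have [col colP] := coding N0 (bad_cubewise i active d).
exists (good alpha i N0 active d), col, (piece_index (k := k) i),
  (@piece _ _ _ _ N0 i0 ai1 active _ d0 ds dt dl), (@radius _ _ alpha i N0 active d).
split.
- exact: good_bilipschitz.
- exact: piece_cover.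
- by move=> n w y; exact: piece_active.
- by move=> n w y z; exact: piece_diam.
split; first by move=> n w; exact: radius_ge0.
move=> N; rewrite (eq_bigr _ (fun n _ => sum_radius _ _ _ _ _ _)) big_split /= -!mulr_sumr.
rewrite [leRHS]mulrDl mul1r; apply: lerD.
  have := volume_stop_markov N0 N (bad_cubewise i active d).
  have : \sum_(n < N) volume (bad i active d) n <= B.
    apply: le_trans (hB d d0 ds dt dl dp N); apply: ler_sum => n _.
    by apply: volume_le => y /andP[].
  set V := \sum_(n < N) _; set W := \sum_(n < N) _ => VB WV.
  have N1 : 0 < N0.+1%:R :> R by rewrite ltr0n.
  rewrite -(ler_pM2l N1) mulrCA.
  apply: le_trans N0B; rewrite ler_wpM2l ?exprn_ge0 //.
  exact: le_trans VB.
have := volume_stop_le 0 N (collapsed_cubewise alpha i active d).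
set V := \sum_(n < N) _ => V2.
have K0 : 0 <= (4 * 2 ^ i)%:R ^+ k * (33 * alpha) ^+ k.+1.
  by rewrite mulr_ge0 ?exprn_ge0 ?mulr_ge0 // ltW.
apply: (le_trans (ler_wpM2l K0 V2)).
(* The number of tubes is of order $\alpha^{-k}$, which leaves one of the $k+1$ powers of
   [alpha]. *)
have -> : (4 * 2 ^ i)%:R ^+ k * (33 * alpha) ^+ k.+1 * (2 ^ k.+1)%:R =
    (4 * (alpha * 2 ^+ i)) ^+ k * (66 ^+ k.+1 * alpha) :> R.
  have -> : 66 = 33 * 2 :> R by ring.
  rewrite natrM !natrX !exprMn !exprS; ring.
rewrite mulrA ler_wpM2r ?(ltW a0) // ler_wpM2r ?exprn_ge0 //.
by rewrite lerXn2r ?nnegrE // ?mulr_ge0 ?exprn_ge0 ?(ltW a0) //; lra.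
Qed.

(** * Hausdorff content and McShane extension *)

Lemma diam_le (R : realType) (T : metricType R) (U : set T) (r : R) : 0 <= r ->
  (forall x y, U x -> U y -> mdist x y <= r) -> (diam U <= r%:E)%E.
Proof.
move=> r0 Ur; apply: ge_ereal_sup => _ [->|[p [p1 p2] <-]]; first by rewrite lee_fin.
by rewrite lee_fin Ur.
Qed.

Lemma diam_ge0 (R : realType) (T : metricType R) (U : set T) : (0 <= diam U)%E.
Proof. by apply: ereal_sup_ubound; left. Qed.

Lemma lee_expe (R : realType) (x : \bar R) (r : R) k : (0 <= x)%E ->
  (x <= r%:E)%E -> (x ^+ k <= (r ^+ k)%:E)%E.
Proof.
case: x => // x; rewrite !lee_fin -EFin_expe lee_fin => x0 xr.
by rewrite lerXn2r ?nnegrE // (le_trans x0).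
Qed.

Lemma hcontent_le (R : realType) (T : metricType R) k (E : set T)
    (I : nat -> finType) (U : forall n, I n -> set T) (r : forall n, I n -> R) (B : R) :
  (0 < k)%N -> (forall n w, 0 <= r n w) ->
  (forall n w x y, U n w x -> U n w y -> mdist x y <= r n w) ->
  (forall N, \sum_(n < N) \sum_w r n w ^+ k <= B) ->
  (forall x, E x -> exists n w, U n w x) ->
  (hcontent k E <= B%:E)%E.
Proof.
move=> k0 r0 Ur rB EU.
pose code := {n : nat & I n}.
pose W j : set T := if pickle_inv j is Some c then U (tag (c : code)) (tagged c) else set0.
pose g j : R := if pickle_inv j is Some c then r (tag (c : code)) (tagged c) else 0.
have g0 j : 0 <= g j by rewrite /g; case: pickle_inv.
have diamW j : (diam (W j) <= (g j)%:E)%E.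
  by apply: diam_le => // x y; rewrite /W /g; case: pickle_inv => // c; exact: Ur.
have sum_g m : \sum_(j < m) g j ^+ k <= B.
  pose N := (\max_(j < m) (if pickle_inv j is Some c then tag (c : code) else 0)).+1%N.
  apply: le_trans (rB N).
  apply: (@le_trans _ _ (\sum_(n < N) \sum_w \sum_(j < m)
      (if pickle (Tagged I w) == j then r n w ^+ k else 0))); last first.
    apply: ler_sum => n _; apply: ler_sum => w _.
    rewrite -big_mkcond /=; have [lt|ge] := ltnP (pickle (Tagged I w)) m.
      by rewrite (big_pred1 (Ordinal lt)) // => j; rewrite eq_sym.
    by rewrite big_pred0 ?exprn_ge0 // => j; rewrite gtn_eqF // (leq_trans (ltn_ord j)).
  rewrite (eq_bigr (fun n : 'I_N => \sum_(j < m) \sum_w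
     (if pickle (Tagged I w) == j then r n w ^+ k else 0))); last first.
    by move=> n _; rewrite exchange_big.
  rewrite exchange_big /=; apply: ler_sum => j _; rewrite /g.
  have pos (n : nat) w : 0 <= (if pickle (Tagged I w) == j then r n w ^+ k else 0).
    by case: ifP; rewrite ?exprn_ge0.
  case e : pickle_inv => [c|]; last first.
    by rewrite expr0n gtn_eqF // sumr_ge0 // => n _; rewrite sumr_ge0.
  have cN : (tag c < N)%N.
    have := @leq_bigmax _ (fun j : 'I_m =>
      if pickle_inv j is Some c then tag (c : code) else 0%N) j.
    by rewrite e ltnS.
  rewrite (bigD1 (Ordinal cN)) //= (bigD1 (tagged c)) //=.
  have -> : Tagged I (tagged c) = c by case: (c).
  have := pickle_invK (T := code) j; rewrite e /= => ->; rewrite eqxx -addrA lerDl.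
  by rewrite addr_ge0 ?sumr_ge0 // => n _; rewrite sumr_ge0.
apply: (@le_trans _ _ (\sum_(0 <= j <oo) diam (W j) ^+ k)%E).
  apply: ereal_inf_lbound; exists W => // x /EU[n [w Uwx]].
  by exists (pickle (Tagged I w : code)); rewrite // /W pickleK_inv.
apply: lime_le.
  by apply: is_cvg_nneseries => j _ _; rewrite expe_ge0 // diam_ge0.
apply: nearW => m; apply: (@le_trans _ _ (\sum_(0 <= j < m) (g j ^+ k)%:E)%E).
  by apply: lee_sum => j _; apply: lee_expe; rewrite ?diam_ge0.
by rewrite sumEFin lee_fin big_mkord.
Qed.

Section McShane.
Context {R : realType} {k : nat} (T : metricType R) (f : 'rV[R]_k -> T).
Variables (S : set 'rV[R]_k) (K eps : R).
Hypothesis S_neq0 : S !=set0.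
Hypothesis K_ge0 : 0 <= K.
Hypothesis f_lip : forall x y, S x -> S y -> mdist (f x) (f y) <= K * `|x - y| + eps.
Implicit Types x y p : 'rV[R]_k.

(** The McShane extension of the distance to [f p]; as [f] is only coarsely Lipschitz, it agrees
    with that distance on [S] up to [eps]. *)
Definition mcshane p x : R := inf [set mdist (f p) (f y) + K * `|x - y| | y in S].

Let mcshane_le p x y : S y -> mcshane p x <= mdist (f p) (f y) + K * `|x - y|.
Proof.
move=> Sy; apply: ge_inf; last by exists y.
by exists 0 => _ [z _ <-]; rewrite addr_ge0 ?mdist_ge0 ?mulr_ge0.
Qed.

Let mcshane_ge p x c : (forall y, S y -> c <= mdist (f p) (f y) + K * `|x - y|) ->
  c <= mcshane p x.
Proof.
move=> h; apply: lb_le_inf => [|_ [y Sy <-]]; last exact: h.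
by have [y Sy] := S_neq0; exists (mdist (f p) (f y) + K * `|x - y|), y.
Qed.

Let mcshane_lip p x y : `|mcshane p x - mcshane p y| <= K * `|x - y|.
Proof.
have h u v : mcshane p u - K * `|u - v| <= mcshane p v.
  apply: mcshane_ge => z Sz; rewrite lerBlDr; apply: (le_trans (mcshane_le _ _ Sz)).
  rewrite -addrA lerD2l -mulrDr ler_wpM2l // [leRHS]addrC.
  exact: ler_distD.
have := h x y; have := h y x; rewrite (distrC y) => h1 h2.
by rewrite ler_norml; apply/andP; split; lra.
Qed.

Let mcshane_near p x : S x ->
  mdist (f p) (f x) - eps <= mcshane p x <= mdist (f p) (f x).
Proof.
move=> Sx; apply/andP; split; last first.
  by apply: (le_trans (mcshane_le _ _ Sx)); rewrite subrr normr0 mulr0 addr0.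
apply: mcshane_ge => y Sy; have := metric_triangle (f p) (f y) (f x).
have := f_lip Sy Sx; rewrite distrC; lra.
Qed.

(** The sup distance of the Kuratowski embedding, with each coordinate replaced by its McShane
    extension. *)
Definition mcshane_dist x y : R := sup [set `|mcshane p x - mcshane p y| | p in S].

Let dist_ge p x y : S p -> `|mcshane p x - mcshane p y| <= mcshane_dist x y.
Proof.
move=> Sp; apply: ub_le_sup; last by exists p.
by exists (K * `|x - y|) => _ [q _ <-].
Qed.

Let dist_le x y c : (forall p, S p -> `|mcshane p x - mcshane p y| <= c) ->
  mcshane_dist x y <= c.
Proof.
move=> h; apply: ge_sup => [|_ [p Sp <-]]; last exact: h.
by have [p Sp] := S_neq0; exists `|mcshane p x - mcshane p y|, p.
Qed.

Lemma mcshane_dist_refl x : mcshane_dist x x = 0.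
Proof.
have [p Sp] := S_neq0; apply/eqP; rewrite eq_le; apply/andP; split.
  by apply: dist_le => q _; rewrite subrr normr0.
by apply: le_trans (dist_ge x x Sp).
Qed.

Lemma mcshane_dist_sym x y : mcshane_dist x y = mcshane_dist y x.
Proof.
by apply/eqP; rewrite eq_le; apply/andP; split; apply: dist_le => p Sp;
  rewrite distrC; exact: dist_ge.
Qed.

Lemma mcshane_dist_triangle x y z :
  mcshane_dist x z <= mcshane_dist x y + mcshane_dist y z.
Proof.
apply: dist_le => p Sp; rewrite -(subrKA (mcshane p y)).
apply: (le_trans (ler_normD _ _)); apply: lerD; exact: dist_ge.
Qed.

Lemma mcshane_dist_lip x y : mcshane_dist x y <= K * `|x - y|.
Proof. exact: dist_le. Qed.

Lemma mcshane_dist_near x y : S x -> S y ->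
  `|mcshane_dist x y - mdist (f x) (f y)| <= eps.
Proof.
move=> Sx Sy; rewrite ler_distl; apply/andP; split.
  (* The lower bound uses the coordinate [p = x]. *)
  apply: le_trans (dist_ge x y Sx); rewrite distrC.
  apply: le_trans (ler_norm _).
  have /andP[_] := mcshane_near x Sx; have /andP[h _] := mcshane_near x Sy.
  rewrite mdistxx; lra.
apply: dist_le => p Sp.
have /andP[h1 h2] := mcshane_near p Sx; have /andP[h3 h4] := mcshane_near p Sy.
have := metric_triangle (f p) (f x) (f y); have := metric_triangle (f p) (f y) (f x).
rewrite (metric_sym (f y) (f x)) => h5 h6.
by rewrite ler_norml; apply/andP; split; lra.
Qed.

End McShane.

(** * Passage from the pseudometric to the coarse Lipschitz map *)

Lemma eucl_dist_le (R : realType) k (x y : 'rV[R]_k) :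
  eucl_dist x y <= k%:R * `|x - y|.
Proof.
rewrite -[leRHS]ger0_norm ?mulr_ge0 // -sqrtr_sqr ler_sqrt ?sqr_ge0 //.
apply: (@le_trans _ _ (k%:R * `|x - y| ^+ 2)).
  rewrite -[k in k%:R]card_ord mulr_natl -sumr_const; apply: ler_sum => j _.
  rewrite -[_ ^+ 2]ger0_norm ?sqr_ge0 // normrX lerXn2r ?nnegrE //.
  by have := norm_coord (x - y) j; rewrite !mxE.
rewrite exprMn ler_wpM2r ?sqr_ge0 // -natrX ler_nat.
by case: (k) => // k'; rewrite expnS leq_pmulr.
Qed.

Lemma dyadic_level (R : realType) (s : R) : 0 < s -> s <= 1 ->
  exists n, 2 ^- n <= s < 2 / 2 ^+ n.
Proof.
move=> s0 s1.
have ex : exists n, 2 ^- n <= s.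
  have si : 0 <= s^-1 by rewrite invr_ge0 ltW.
  exists (Num.bound s^-1); rewrite -[leRHS]invrK lef_pV2 ?posrE ?invr_gt0 ?expr2_gt0 //.
  apply: ltW (lt_trans (archi_boundP si) _).
  by move: (Num.bound _) => M; rewrite -natrX ltr_nat ltn_expl.
case: (ex_minnP ex) => n hn nmin; exists n; rewrite hn /=.
case: n hn nmin => [|n] hn nmin; first by rewrite expr0 divr1; lra.
rewrite exprS invfM mulrA divff // mul1r ltNge.
by apply/negP => /nmin; rewrite ltnn.
Qed.

Theorem theorem1p1 (R : realType) :
  exists c2 : R, forall k : nat, (1 <= k)%N ->
  exists c1 : R, forall alpha : R, 0 < alpha -> alpha < 1 ->
  exists M : nat,
  forall (eps : R) (T : metricType R) (f : 'rV[R]_k -> T),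
    0 <= eps -> coarse_lipschitz1 eps f ->
    exists F : 'I_M -> set 'rV[R]_k,
      [/\ forall i, F i `<=` @unit_cube R k,
          forall (i : 'I_M) (x y : 'rV[R]_k), F i x -> F i y ->
            alpha * eucl_dist x y - c2 * eps <= mdist (f x) (f y) /\
            mdist (f x) (f y) <= eucl_dist x y + eps
        & (hcontent k (f @` (@unit_cube R k `\` \bigcup_i F i))
             <= (c1 * alpha)%:E)%E].
Proof.
(* The [2] comes from pairs at inactive levels, where [alpha * K * |x - y|] is below [2 * eps]; at
   active levels one [eps] suffices. *)
exists 2 => -[//|k] _; have [c1 [c1_ge0 core]] := pseudometric_decomposition R k.
pose K : R := k.+1%:R; have K0 : 0 < K by rewrite ltr0n.
exists ((2 * K) ^+ k.+1 * c1) => alpha a0 a1; have [C {}core] := core alpha a0 a1.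
exists #|C| => eps T f eps0 f_lip.
pose cube1 := @unit_cube R k.+1.
have cube_neq0 : cube1 !=set0 by exists 0 => j; rewrite mxE lexx ler01.
have f_lip' x y : cube1 x -> cube1 y -> mdist (f x) (f y) <= K * `|x - y| + eps.
  by move=> cx cy; apply: (le_trans (f_lip _ _ cx cy)); rewrite lerD2r eucl_dist_le.
pose rho := mcshane_dist f cube1 K.
pose d (x y : 'rV[R]_k.+1) := rho (fold x) (fold y) / K.
(* At active levels [eps] is at most [K] times the radius of any nonempty piece, so passing from [d]
   back to [f] at most doubles the diameters; hence the factor [2 * K]. *)
pose active n := eps <= alpha * K * 2 ^- n.
have dK x y : cube1 x -> cube1 y -> `|K * d x y - mdist (f x) (f y)| <= eps.
  move=> cx cy; rewrite /d !fold_id // mulrC divfK ?gt_eqF //.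
  by apply: mcshane_dist_near => //; exact: ltW.
have [||||| good [col [I [A [r [good_lip cover A_active A_diam [r0 rsum]]]]]]] := core active d.
- by move=> x; rewrite /d /rho mcshane_dist_refl ?mul0r // ltW.
- by move=> x y; rewrite /d /rho mcshane_dist_sym // ltW.
- move=> x y z; rewrite /d /rho -mulrDl ler_pM2r ?invr_gt0 //.
  by apply: mcshane_dist_triangle => //; exact: ltW.
- move=> x y; rewrite /d ler_pdivrMr // mulrC.
  apply: (le_trans (mcshane_dist_lip f cube_neq0 (ltW K0) _ _)).
  by rewrite ler_pM2l // fold_lip.
- by move=> x y u; rewrite /d !fold_periodic.
(* The sets are the colour classes of the good points; the set of colours was fixed before [f]. *)
exists (fun i => [set x | [/\ cube1 x, good x & col x = enum_val i]]); split.
- by move=> i x [].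
- move=> i x y [cx gx colx] [cy gy coly]; split; last exact: f_lip.
  have exy : alpha * eucl_dist x y <= alpha * (K * `|x - y|).
    by rewrite ler_pM2l // eucl_dist_le.
  have [xy0|xy0] := eqVneq x y.
    by move: exy; rewrite xy0 subrr normr0 !mulr0; have := mdist_ge0 (f y) (f y); lra.
  have s0 : 0 < `|x - y| by rewrite normr_gt0 subr_eq0.
  have s1 : `|x - y| <= 1.
    apply: norm_le => // j; rewrite !mxE.
    have /andP[? ?] := cx j; have /andP[? ?] := cy j.
    by rewrite ler_norml; apply/andP; split; lra.
  have [n xyn] := dyadic_level s0 s1.
  have [an|] := boolP (active n).
    have := good_lip x y n gx gy (etrans colx (esym coly)) an xyn.
    rewrite -(ler_pM2l K0) => h; have := dK x y cx cy; rewrite ler_norml => /andP[_ h2].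
    lra.
  rewrite -ltNge => en; have /andP[_ xy2] := xyn.
  have : alpha * K * `|x - y| < alpha * K * (2 / 2 ^+ n) by rewrite ltr_pM2l // mulr_gt0.
  by have := mdist_ge0 (f x) (f y); lra.
apply: (@hcontent_le _ _ _ _ I (fun n w => f @` (cube1 `&` A n w)) (fun n w => 2 * K * r n w)).
- by [].
- by move=> n w; rewrite !mulr_ge0 // ltW.
- move=> n w _ _ [x [cx Ax] <-] [y [cy Ay] <-].
  have [an rn] := A_active n w x Ax.
  have dxy := A_diam n w x y Ax Ay; rewrite -(ler_pM2l K0) in dxy.
  have := dK x y cx cy; rewrite ler_norml => /andP[h1 h2].
  have : K * (alpha * 2 ^- n) <= K * r n w by rewrite ler_pM2l.
  by move: an; rewrite /active; lra.
- move=> N; apply: (@le_trans _ _ ((2 * K) ^+ k.+1 * \sum_(n < N) \sum_w r n w ^+ k.+1)).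
    rewrite mulr_sumr; apply: ler_sum => n _; rewrite mulr_sumr; apply: ler_sum => w _.
    by rewrite exprMn.
  by rewrite -mulrA ler_wpM2l // exprn_ge0 // mulr_ge0 // ltW.
- move=> _ [x [cx nF] <-].
  have ng : ~ good x.
    move=> gx; apply: nF; exists (enum_rank (col x)) => //; split=> //.
    by rewrite enum_rankK.
  by have [n [w Aw]] := cover x cx ng; exists n, w, x.
Qed.
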